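(* Let $\Omega\subseteq\mathbb{R}^n$ be open and bounded, let $f\in\mathcal{F}_2(\mathbb{R}^m)$ be convex and non-negative, and let $M\subseteq\mathbf{Y}$ be a set of generalized Young measures such that (i) $M\neq\varnothing$, and (ii) $M$ is sequentially compact with respect to the weak-$\ast$ topology of $\mathbf{Y}$, i.e. any sequence in $M$ has a weakly-$\ast$ converging subsequence with limit in $M$. Then there exists $(\nu,\lambda,\nu^\infty)\in M$ which is maximal, i.e. which satisfies $$\mathcal{V}_f[\nu,\lambda,\nu^\infty]=\max_{(\widetilde\nu,\widetilde\lambda,\widetilde\nu^\infty)\in M}\mathcal{V}_f[\widetilde\nu,\widetilde\lambda,\widetilde\nu^\infty].$$
   Context: Let $n,m\in\mathbb{N}$ and $\Omega\subseteq\mathbb{R}^n$ open and bounded. $\mathcal{M}(X)$, $\mathcal{M}^+(X)$, $\mathcal{P}(X)$ denote the finite, the non-negative finite, and the probability Radon measures on $X$; $\mathcal{S}^{m-1}$ is the unit sphere in $\mathbb{R}^m$. For a measure $\mu$ on a set $D$, $L^\infty_{\rm weak}(D,\mu;\mathcal{P}(X))$ is the space of maps $\nu:D\to\mathcal{P}(X)$ such that $x\mapsto\langle\nu_x,g\rangle:=\int_X g(z)\,d\nu_x(z)$ is $\mu$-measurable for every bounded Borel $g:X\to\mathbb{R}$ ($\mu$ is omitted if it is Lebesgue measure). $\langle\nu_x,\cdot\rangle:=\int z\,d\nu_x(z)\in\mathbb{R}^m$ is the barycenter. A generalized Young measure is a triple $(\nu,\lambda,\nu^\infty)$ with $\nu\in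 L^\infty_{\rm weak}(\Omega;\mathcal{P}(\mathbb{R}^m))$, $\lambda\in\mathcal{M}^+(\overline\Omega)$, $\nu^\infty\in L^\infty_{\rm weak}(\overline\Omega,\lambda;\mathcal{P}(\mathcal{S}^{m-1}))$ satisfying $\int_\Omega\langle\nu_x,|\cdot|^2\rangle\,dx+\lambda(\overline\Omega)<\infty$. The set of all generalized Young measures is $\mathbf{Y}$. $\mathcal{A}(\mathbb{R}^m)$ is the set of bounded continuous $f_0:\mathbb{R}^m\to\mathbb{R}$ such that $\lim_{s\to\infty}f_0(sz)$ exists and is continuous in $z\in\mathcal{S}^{m-1}$. $\mathcal{F}_2(\mathbb{R}^m)$ is the set of $f\in C(\mathbb{R}^m)$ of the form $f=(1+|\cdot|^2)f_0$ with $f_0\in\mathcal{A}(\mathbb{R}^m)$. The recession function is $f^\infty:\mathcal{S}^{m-1}\to\mathbb{R}$, $f^\infty(z)=\lim_{s\to\infty}\frac{f(sz)}{1+s^2}$. Weak-$\ast$ topology: $(\nu^k,\lambda^k,(\nu^\infty)^k)\to(\nu,\lambda,\nu^\infty)$ in $\mathbf{Y}$ iff for all $\phi\in C(\overline\Omega)$ and $f\in\mathcal{F}_2(\mathbb{R}^m)$: $\int_\Omega\phi\langle\nu^k_x,f\rangle\,dx+\int_{\overline\Omega}\phi\langle(\nu^\infty)^k_x,f^\infty\rangle\,d\lambda^k(x)\to\int_\Omega\phi\langle\nu_x,f\rangle\,dx+\int_{\overline\Omega}\phi\langle\nu^\infty_x,f^\infty\rangle\,d\lambda(x)$. For convex non-negative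 $f\in\mathcal{F}_2(\mathbb{R}^m)$, $$\mathcal{V}_f[\nu,\lambda,\nu^\infty]=\int_\Omega\big[\langle\nu_x,f\rangle-f(\langle\nu_x,\cdot\rangle)\big]dx+\int_{\overline\Omega}\langle\nu^\infty_x,f^\infty\rangle\,d\lambda(x).$$ *)

(* Defs.v *)
From HB Require Import structures.
From mathcomp Require Import all_boot all_order all_algebra.
From mathcomp Require Import all_classical all_reals all_analysis.
From mathcomp Require Import measurable_realfun.

Set Implicit Arguments.
Unset Strict Implicit.
Unset Printing Implicit Defensive.
Import Order.TTheory GRing.Theory Num.Theory.
Import numFieldNormedType.Exports.

Local Open Scope classical_set_scope.
Local Open Scope ring_scope.

Section borel_rV.
Context {R : realType} {n : nat}.
Let O := @open 'rV[R]_n.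

(* the Borel sigma-algebra of R^n *)
HB.instance Definition _ := @isMeasurable.Build (sigma_display O) 'rV[R]_n
  <<s O >> (@sigma_algebra0 _ setT O) (@sigma_algebraC _ O)
  (@sigma_algebra_bigcup _ setT O).

Lemma open_measurable_rV (U : set 'rV[R]_n) : open U -> measurable U.
Proof. exact: sub_sigma_algebra. Qed.

Lemma continuous_measurable_rV_fun (f : 'rV[R]_n -> R) :
  continuous f -> measurable_fun setT f.
Proof.
move=> /continuousP cf; apply: (measurability _ (RGenOInfty.measurableE R)).
move=> _ [_ [x ->] <-]; rewrite setTI; apply: open_measurable_rV.
by apply: cf; exact: interval_open.
Qed.

Lemma rV_open_countable_balls (U : set 'rV[R]_n) : open U ->
  U = \bigcup_(i in [set i : 'rV[rat]_n * nat |
        ball (map_mx ratr i.1 : 'rV[R]_n) i.2.+1%:R^-1 `<=` U])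
      ball (map_mx ratr i.1 : 'rV[R]_n) i.2.+1%:R^-1.
Proof.
move=> oU; apply/seteqP; split=> [x Ux|x [i /= iU ix]]; last exact: iU.
have := oU; rewrite openE => /(_ _ Ux)/nbhs_ballP[_/posnumP[e] xeU].
have [k _ /(_ k (leqnn k)) /= ke] := near_infty_natSinv_lt (e%:num / 2)%:pos.
have kpos : 0 < k.+1%:R^-1 :> R by rewrite invr_gt0.
have q_ j : {q : rat | ball (x 0 j) k.+1%:R^-1 (ratr q)}.
  apply: cid; have [||z [xz [q _ qE]]] := @dense_rat R (ball (x 0 j) k.+1%:R^-1).
  - by exists (x 0 j); exact: ballxx.
  - exact: ball_open.
  - by exists q; rewrite qE.
have qx : ball (map_mx ratr (\row_j sval (q_ j)) : 'rV[R]_n) k.+1%:R^-1 x.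
  split=> // i j; rewrite !mxE ord1; apply: ball_sym; exact: svalP (q_ j).
exists (\row_j sval (q_ j), k) => //= y qy; apply: xeU.
rewrite (splitr e%:num).
apply: (@ball_triangle _ _ (map_mx ratr (\row_j sval (q_ j)) : 'rV[R]_n)).
  by apply: le_ball (ball_sym qx); exact: ltW.
by apply: le_ball qy; exact: ltW.
Qed.

End borel_rV.

Section lebesgue_rV.
Context {R : realType}.

Definition cons_rV n (p : R * 'rV[R]_n) : 'rV[R]_n.+1 :=
  \row_j oapp (p.2 0) p.1 (unlift ord0 j).

Definition uncons_rV n (x : 'rV[R]_n.+1) : R * 'rV[R]_n :=
  (x 0 ord0, \row_j x 0 (lift ord0 j)).

Lemma cons_rVK n : cancel (@cons_rV n) (@uncons_rV n).
Proof.
move=> [x y]; rewrite /uncons_rV /cons_rV mxE unlift_none /=; congr pair.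
by apply/rowP => j; rewrite !mxE liftK.
Qed.

Lemma uncons_rVK n : cancel (@uncons_rV n) (@cons_rV n).
Proof.
move=> x; apply/rowP => j; rewrite mxE /=.
by case: unliftP => [k|] -> //=; rewrite mxE.
Qed.

Lemma measurable_uncons_rV n : measurable_fun setT (@uncons_rV n).
Proof.
apply/measurable_fun_pair.
  by apply: continuous_measurable_rV_fun; exact: coord_continuous.
apply: (@measurability _ _ _ 'rV[R]_n setT _ (@open 'rV[R]_n) erefl).
move=> _ [U oU <-]; rewrite setTI; apply: open_measurable_rV.
suff /continuousP : continuous (fun x : 'rV[R]_n.+1 => \row_j x 0 (lift ord0 j)).
  exact.
move=> x A /nbhs_ballP[e /= e0 eA].
apply/nbhs_ballP; exists e => //= y [_ xy]; apply: eA; split => // i j.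
by rewrite !mxE; exact: xy.
Qed.

Lemma cons_rV_ball n (c : 'rV[R]_n.+1) (e : R) : 0 < e ->
  @cons_rV n @^-1` ball c e =
  ball (uncons_rV c).1 e `*` ball (uncons_rV c).2 e.
Proof.
move=> e0; apply/seteqP; split => [[x y] [_ ce]|[x y] /= [cx [_ cy]]].
  split; first by have := ce 0 ord0; rewrite mxE unlift_none.
  by split=> // i j; have := ce i (lift ord0 j); rewrite !mxE liftK /= !ord1.
split=> // i j; rewrite mxE ord1.
case: unliftP => [k|] -> //=.
by have := cy 0 k; rewrite mxE.
Qed.

Lemma measurable_cons_rV n : measurable_fun setT (@cons_rV n).
Proof.
apply: (@measurability _ _ _ 'rV[R]_n.+1 setT _ (@open 'rV[R]_n.+1) erefl).
move=> _ [U oU <-]; rewrite setTI (rV_open_countable_balls oU).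
rewrite preimage_bigcup bigcup_mkcond.
apply: countable_bigcupT_measurable => // -[q k].
case: ifPn => // _; rewrite cons_rV_ball ?invr_gt0//.
apply: measurableX; first exact: measurable_ball.
by apply: open_measurable_rV; exact: ball_open.
Qed.

Section lebesgue_cons.
Variables (n : nat) (mu : {sigma_finite_measure set 'rV[R]_n -> \bar R}).
Local Open Scope ereal_scope.

Definition lebesgue_cons : set 'rV[R]_n.+1 -> \bar R :=
  pushforward (@lebesgue_measure R \x mu) (@cons_rV n).

Let lebesgue_cons0 : lebesgue_cons set0 = 0.
Proof. by rewrite /lebesgue_cons /pushforward preimage_set0 measure0. Qed.

Let lebesgue_cons_ge0 A : 0 <= lebesgue_cons A.
Proof. by rewrite /lebesgue_cons /pushforward; exact: measure_ge0. Qed.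

Let lebesgue_cons_sigma_additive : semi_sigma_additive lebesgue_cons.
Proof.
exact: (@measure_semi_sigma_additive _ _ _
  (measure_function_pushforward__canonical__measure_function_Measure
     (@lebesgue_measure R \x mu) (@measurable_cons_rV n))).
Qed.

HB.instance Definition _ := isMeasure.Build _ _ _ lebesgue_cons
  lebesgue_cons0 lebesgue_cons_ge0 lebesgue_cons_sigma_additive.

Let lebesgue_cons_sigma_finite : sigma_finite setT lebesgue_cons.
Proof.
have /sigma_finiteP[F [FT ndF Foo]] := sigma_finiteT (@lebesgue_measure R).
have /sigma_finiteP[G [GT ndG Goo]] := sigma_finiteT mu.
exists (fun k => @uncons_rV n @^-1` (F k `*` G k)).
  apply/esym; rewrite -subTset => x _.
  have [k _ Fk] : (\bigcup_k F k) (uncons_rV x).1 by rewrite -FT.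
  have [l _ Gl] : (\bigcup_k G k) (uncons_rV x).2 by rewrite -GT.
  exists (maxn k l) => //; split.
  - by move: Fk; exact/subsetPset/ndF/leq_maxl.
  - by move: Gl; exact/subsetPset/ndG/leq_maxr.
move=> k; have [mFk Fkoo] := Foo k; have [mGk Gkoo] := Goo k; split.
  rewrite -[X in measurable X]setTI; apply: measurable_uncons_rV => //.
  exact: measurableX.
rewrite /lebesgue_cons /pushforward -comp_preimage.
rewrite (_ : _ \o _ = id); last by apply/funext => x /=; rewrite cons_rVK.
by rewrite preimage_id product_measure1E// lte_mul_pinfty// ge0_fin_numE.
Qed.

HB.instance Definition _ := Measure_isSigmaFinite.Build _ _ _ lebesgue_cons
  lebesgue_cons_sigma_finite.

End lebesgue_cons.

(* n-dimensional Lebesgue measure on the Borel sets, as the n-fold product of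
   one-dimensional Lebesgue measure; see [lebesgue_rV_box]. *)
Fixpoint lebesgue_rV n : {sigma_finite_measure set 'rV[R]_n -> \bar R} :=
  match n with
  | 0 => \d_(0 : 'rV[R]_0)
  | n'.+1 => lebesgue_cons (lebesgue_rV n')
  end.

Lemma measurable_box_rV n (a b : 'rV[R]_n) :
  measurable [set x : 'rV[R]_n | forall j, a 0 j < x 0 j <= b 0 j].
Proof.
rewrite [X in measurable X](_ : _ = \bigcap_(j in [set: 'I_n])
  [set x : 'rV[R]_n | a 0 j < x 0 j <= b 0 j]).
  apply: fin_bigcap_measurable; first exact: finite_finset.
  move=> j _.
  have mj : measurable_fun [set: 'rV[R]_n] (fun x : 'rV[R]_n => x 0 j).
    by apply: continuous_measurable_rV_fun; exact: coord_continuous.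
  have -> : [set x : 'rV[R]_n | a 0 j < x 0 j <= b 0 j] =
      (fun x : 'rV[R]_n => x 0 j) @^-1` `]a 0 j, b 0 j]%classic.
    by apply/seteqP; split => x /=; rewrite in_itv.
  by rewrite -[X in measurable X]setTI; exact: mj.
apply/seteqP; split => x /= H j; first by move=> _; exact: H.
exact: H.
Qed.

Lemma lebesgue_rV_box n (a b : 'rV[R]_n) : (forall j, a 0 j <= b 0 j) ->
  lebesgue_rV n [set x | forall j, a 0 j < x 0 j <= b 0 j] =
  (\prod_j (b 0 j - a 0 j))%:E.
Proof.
elim: n => [|n IHn] in a b *; move=> ab.
  by rewrite big_ord0 /= diracE mem_set// => -[].
rewrite /= /lebesgue_cons /pushforward.
rewrite (_ : _ @^-1` _ = `]a 0 ord0, b 0 ord0]%classic `*`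
  [set x : 'rV[R]_n | forall j, (uncons_rV a).2 0 j < x 0 j <= (uncons_rV b).2 0 j]).
  rewrite product_measure1E//; last exact: measurable_box_rV.
  rewrite IHn; last by move=> j; rewrite !mxE.
  have := @lebesgue_measure_itv R `]a 0 ord0, b 0 ord0].
  rewrite /= lte_fin => ->; rewrite big_ord_recl EFinM; congr (_ * _)%E.
    by case: ltgtP (ab ord0) => // -> _; rewrite subrr.
  by congr EFin; apply: eq_bigr => j _; rewrite !mxE.
apply/seteqP; split => [[x y] /= H|[x y] /= [xab yab] j].
  split; first by have := H ord0; rewrite mxE unlift_none in_itv.
  by move=> j; have := H (lift ord0 j); rewrite !mxE liftK.
rewrite mxE; case: unliftP => [k|] -> /=; last by move: xab; rewrite in_itv.
by have := yab k; rewrite !mxE.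
Qed.

End lebesgue_rV.

Section young_measures.
Context {R : realType}.

(* [`|z|] is the sup norm on ['rV[R]_m]; moments, the sphere and the growth
   condition use the Euclidean norm. *)
Definition enorm m (z : 'rV[R]_m) : R := Num.sqrt (\sum_i z 0 i ^+ 2).

Definition usphere m : set 'rV[R]_m := [set z | enorm z = 1].

(* Measurability of the restriction of h to D with respect to the completion of
   mu. The library integral of such a function for the uncompleted measure mu,
   being built from suprema over simple functions, is the integral for the
   completion. *)
Definition mu_measurable d (T : measurableType d) (mu : set T -> \bar R)
    (D : set T) (h : T -> R) :=
  forall B : set R, measurable B -> completed_algebra_gen mu (D `&` h @^-1` B).

(* L^oo_weak(D, mu; P(X)): a probability measure on X is a Borel probability
   measure on R^m giving mass 1 to X. The values of nu outside D are irrelevant. *)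
Definition Linfty_weak n m (D : set 'rV[R]_n) (mu : set 'rV[R]_n -> \bar R)
    (X : set 'rV[R]_m) (nu : 'rV[R]_n -> probability 'rV[R]_m R) :=
  (forall x, D x -> nu x X = 1%E) /\
  (forall g : 'rV[R]_m -> R, measurable_fun X g -> [bounded g z | z in X] ->
    mu_measurable mu D (fun x => \int[nu x]_(z in X) g z)).

Record young_triple n m := YoungTriple {
  oscillation : 'rV[R]_n -> probability 'rV[R]_m R ;
  concentration : {finite_measure set 'rV[R]_n -> \bar R} ;
  concentration_angle : 'rV[R]_n -> probability 'rV[R]_m R }.

(* A measure on closure Omega is a Borel measure on R^n vanishing outside
   closure Omega. *)
Definition gen_young n m (Omega : set 'rV[R]_n) : set (young_triple n m) :=
  [set Y | [/\ Linfty_weak Omega (lebesgue_rV n) setT (oscillation Y),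
    concentration Y (~` closure Omega) = 0%E,
    Linfty_weak (closure Omega) (concentration Y) (@usphere m)
      (concentration_angle Y) &
    (\int[lebesgue_rV n]_(x in Omega)
        \int[oscillation Y x]_z (enorm z ^+ 2)%:E +
      concentration Y (closure Omega) < +oo)%E ]].

(* the classes A(R^m) and F_2(R^m) *)
Definition radial_class m (f0 : 'rV[R]_m -> R) :=
  [/\ continuous f0, bounded_fun f0,
    (forall z, usphere z -> cvg (f0 (s *: z) @[s --> +oo])) &
    {within @usphere m, continuous (fun z => lim (f0 (s *: z) @[s --> +oo]))}].

Definition quad_class m (f : 'rV[R]_m -> R) :=
  exists2 f0, radial_class f0 & forall z, f z = (1 + enorm z ^+ 2) * f0 z.

Definition recession m (f : 'rV[R]_m -> R) (z : 'rV[R]_m) : R :=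
  lim (f (s *: z) / (1 + s ^+ 2) @[s --> +oo]).

Definition young_pairing n m (Omega : set 'rV[R]_n) (Y : young_triple n m)
    (phi : 'rV[R]_n -> R) (f : 'rV[R]_m -> R) : R :=
  \int[lebesgue_rV n]_(x in Omega) (phi x * \int[oscillation Y x]_z f z) +
  \int[concentration Y]_(x in closure Omega)
    (phi x * \int[concentration_angle Y x]_(z in @usphere m) recession f z).

Definition young_cvg n m (Omega : set 'rV[R]_n)
    (Yk : nat -> young_triple n m) (Y : young_triple n m) :=
  forall (phi : 'rV[R]_n -> R) (f : 'rV[R]_m -> R),
    {within closure Omega, continuous phi} -> quad_class f ->
    young_pairing Omega (Yk k) phi f @[k --> \oo] --> young_pairing Omega Y phi f.

Definition young_seq_compact n m (Omega : set 'rV[R]_n)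
    (M : set (young_triple n m)) :=
  forall Yk : nat -> young_triple n m, (forall k, M (Yk k)) ->
    exists (sigma : nat -> nat) (Y : young_triple n m),
      [/\ {homo sigma : i j / (i < j)%N}, M Y & young_cvg Omega (Yk \o sigma) Y].

Definition barycenter m (p : probability 'rV[R]_m R) : 'rV[R]_m :=
  \row_i \int[p]_z (z 0 i).

Definition young_variance n m (Omega : set 'rV[R]_n) (f : 'rV[R]_m -> R)
    (Y : young_triple n m) : R :=
  \int[lebesgue_rV n]_(x in Omega)
    (\int[oscillation Y x]_z f z - f (barycenter (oscillation Y x))) +
  \int[concentration Y]_(x in closure Omega)
    \int[concentration_angle Y x]_(z in @usphere m) recession f z.

End young_measures.

(* Main.v *)
(* The idea: split the variance as the pairing of the Young measure with
   (1, f) minus the integral of f along the barycenter b. Along a weakly-*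
   convergent sequence the pairings converge by definition, so the variance is
   upper semicontinuous as soon as the integral of f(b) is lower semicontinuous.
   The test functions z_i (recession 0) and 1 + |z|^2 show that the barycenters
   converge against continuous functions and have bounded second moments; hence
   they converge on every Borel set. Since f is a countable supremum of affine
   functions, lower semicontinuity follows for finite maxima by cutting the domain
   into the pieces on which one affine function is active, and then for f by
   dominated convergence. A maximising sequence thus has a maximiser as limit.

   The maps x |-> <nu_x, g> are only measurable for the completed measure; all
   countably many of them become Borel after removal of a single null set. *)
Require Import Defs.
From HB Require Import structures.
From mathcomp Require Import all_boot all_order all_algebra.
From mathcomp Require Import all_classical all_reals all_analysis.
From mathcomp Require Import measurable_realfun.
From mathcomp Require Import ring lra.

Set Implicit Arguments.
Unset Strict Implicit.
Unset Printing Implicit Defensive.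
Import Order.TTheory GRing.Theory Num.Theory.
Import numFieldNormedType.Exports.

Local Open Scope classical_set_scope.
Local Open Scope ring_scope.

(** * Convex functions as suprema of affine functions *)

Lemma continuous_sumr (R : realType) (T : topologicalType) I (r : seq I)
    (F : I -> T -> R) :
  (forall i, continuous (F i)) -> continuous (fun x => \sum_(i <- r) F i x).
Proof.
move=> Fc; apply: (@continuous_big R I +%R 0 xpredT) => //.
exact: (@pseudometric_normed_Zmodule.add_continuous R R).
Qed.

Section convex_minorants.
Context {R : realType} {m : nat}.
Implicit Types (w y z : 'rV[R]_m).

Definition dotr z w : R := \sum_i z 0 i * w 0 i.

Definition affine (h : 'rV[R]_m * R) z : R := dotr h.1 z + h.2.

Lemma dotrDr z w y : dotr z (w + y) = dotr z w + dotr z y.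
Proof. by rewrite -big_split/=; apply: eq_bigr => i _; rewrite mxE mulrDr. Qed.

Lemma dotrZr a z w : dotr z (a *: w) = a * dotr z w.
Proof. by rewrite mulr_sumr; apply: eq_bigr => i _; rewrite mxE mulrCA. Qed.

Lemma dotrC z w : dotr z w = dotr w z.
Proof. by apply: eq_bigr => i _; rewrite mulrC. Qed.

Lemma dotrBr z w y : dotr z (w - y) = dotr z w - dotr z y.
Proof. by rewrite dotrDr -scaleN1r dotrZr mulN1r. Qed.

Lemma normr_coord_le z i : `|z 0 i| <= `|z|.
Proof.
rewrite [leRHS]/Num.norm /= mx_normrE.
by apply/bigmax_geP; right => /=; exists (0, i).
Qed.

Lemma normr_le_dotr z (r : R) : 0 <= r -> dotr z z <= r ^+ 2 -> `|z| <= r.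
Proof.
move=> r0 zr; rewrite [leLHS]/Num.norm /= mx_normrE.
apply/bigmax_leP; split => // -[i j] _ /=; rewrite ord1.
rewrite -(@ler_pXn2r _ 2)// ?nnegrE//; apply: le_trans zr.
rewrite /dotr (bigD1 j)//= real_normK ?num_real// expr2 lerDl.
by apply: sumr_ge0 => k _; rewrite -expr2 sqr_ge0.
Qed.

Lemma dotr_ge0 z : 0 <= dotr z z.
Proof. by apply: sumr_ge0 => i _; rewrite -expr2 sqr_ge0. Qed.

Lemma dotrB_sqr (t : R) z w : dotr (z - t *: w) (z - t *: w) =
  dotr z z - 2 * t * dotr z w + t ^+ 2 * dotr w w.
Proof.
rewrite dotrBr dotrZr dotrC dotrBr dotrZr [dotr (_ - _) w]dotrC dotrBr dotrZr.
by rewrite [dotr w z]dotrC; ring.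
Qed.

Lemma continuous_dotr_sub w : continuous (fun z => dotr (w - z) (w - z)).
Proof.
apply: continuous_sumr => i.
rewrite (_ : (fun z => _) = fun z : 'rV[R]_m => (w 0 i - z 0 i) * (w 0 i - z 0 i)).
  have c z : continuous_at z (fun z : 'rV[R]_m => w 0 i - z 0 i).
    by apply: continuousB; [exact: cst_continuous|exact: coord_continuous].
  by move=> z; exact: (continuousM (c z) (c z)).
by apply/funext => z; rewrite !mxE.
Qed.

(** The factor [m] appears because Cauchy-Schwarz is replaced by a termwise bound in the sup
    norm. *)
Lemma normr_dotr_le z w : `|dotr z w| <= m%:R * (`|z| * `|w|).
Proof.
apply: le_trans (ler_norm_sum _ _ _) _.
rewrite (_ : m%:R * _ = \sum_(i < m) `|z| * `|w|); last first.
  by rewrite sumr_const card_ord mulr_natl.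
apply: ler_sum => i _.
by rewrite normrM ler_pM// normr_coord_le.
Qed.

Variable f : 'rV[R]_m -> R.
Hypothesis f_cont : continuous f.
Hypothesis f_ge0 : forall z, 0 <= f z.
Hypothesis f_convex : convex_function (setT : set (convex_lmodType 'rV[R]_m)) f.

Lemma convex_segment y z (t : R) : 0 <= t <= 1 ->
  f (y + t *: (z - y)) <= f y + t * (f z - f y).
Proof.
move=> /andP[t0 t1].
have := @f_convex (Itv01 t0 t1) z y (in_setT _) (in_setT _).
have -> : conv (Itv01 t0 t1) (z : convex_lmodType 'rV[R]_m) y = y + t *: (z - y).
  rewrite [LHS](_ : _ = t *: z + (1 - t) *: y)//.
  by rewrite scalerBl scale1r scalerBr addrCA.
rewrite convRE /=.
by move=> /le_trans; apply; rewrite /unstable.onem; lra.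
Qed.

(** First-order optimality: divide by [t] and let [t] tend to 0. If [a] were negative, the explicit
    small [t] below would keep [t * b] strictly below [- a]. *)
Lemma ler_lin_quad (a b : R) : 0 <= b ->
  (forall t, 0 < t <= 1 -> 0 <= t * a + t ^+ 2 * b) -> 0 <= a.
Proof.
move=> b0 H; rewrite leNgt; apply/negP => a0.
pose t := Num.min 1 (- a / (2 * (b + 1))).
have b1 : 0 < 2 * (b + 1) by lra.
have t0 : 0 < t by rewrite lt_min ltr01/= divr_gt0// oppr_gt0.
have t1 : t <= 1 by rewrite ge_min lexx.
have tb : t * (2 * (b + 1)) <= - a by rewrite -ler_pdivlMr// ge_min lexx orbT.
have := H t; rewrite t0 t1 => /(_ isT); apply/negP; rewrite -ltNge.
rewrite expr2 -mulrA -mulrDr pmulr_rlt0//; nra.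
Qed.

(* [y] minimises [f + K * |. - w|^2]; its optimality condition is a subgradient
   inequality for [f] at [y]. *)
Lemma convex_prox w (K : R) : 0 < K -> exists y,
  K * dotr (w - y) (w - y) <= f w /\
  forall z, f y + 2 * K * dotr (w - y) (z - y) <= f z.
Proof.
move=> K0.
pose g z := f z + K * dotr (w - z) (w - z).
pose A := [set z | g z <= f w].
have gc : continuous g.
  move=> z; have := continuousM (@cst_continuous 'rV[R]_m R K z) (@continuous_dotr_sub w z).
  exact: (continuousD (@f_cont z)).
have gw : g w = f w by rewrite /g subrr /dotr big1 ?mulr0 ?addr0// => i _; rewrite mxE mul0r.
(* As [f] is non-negative, a point [z] of the sublevel set satisfies [K * |w - z|^2 <= f w], which
   bounds it. *)
have cA : compact A.
  apply: bounded_closed_compact; last first.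
    apply: (@preimage_closed _ _ g [set x | x <= f w]) => [x _|].
      exact: gc.
    exact: closed_le.
  have fK : 0 <= f w / K by rewrite divr_ge0// ltW.
  exists (`|w| + Num.sqrt (f w / K)); split => [|r /ltW wr z /= Az].
    exact: num_real.
  apply: le_trans wr.
  rewrite -(subKr w z) (le_trans (ler_normB _ _))// lerD2l.
  apply: normr_le_dotr; first exact: sqrtr_ge0.
  rewrite sqr_sqrtr// ler_pdivlMr// mulrC.
  by apply: le_trans Az; rewrite lerDr.
have [||y Ay ymin] := @EVT_min_rV R m g A _ cA.
- by exists w; rewrite /A /= gw.
- by apply: continuous_subspaceT.
have {}ymin z : g y <= g z.
  have [gz|gz] := leP (g z) (f w); first by apply: ymin; rewrite inE.
  by move: Ay; rewrite inE /A /= => /le_trans; apply; exact: ltW.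
exists y; split.
  by have := ymin w; rewrite gw; apply: le_trans; rewrite lerDr.
move=> z; rewrite -subr_ge0.
(* The minimiser is compared with [y + t *: (z - y)]. Convexity makes the increment of [f] at most
   linear in [t], and the penalty contributes the linear term of the claim and a quadratic
   remainder. *)
apply: (@ler_lin_quad _ (K * dotr (z - y) (z - y))).
  by rewrite mulr_ge0 ?dotr_ge0// ltW.
move=> t /andP[t0 t1].
have := le_trans (ymin (y + t *: (z - y)))
  (lerD (convex_segment y z _) (lexx _)).
rewrite (ltW t0) t1 => /(_ isT).
rewrite /g opprD addrA dotrB_sqr.
by move=> H; rewrite expr2; lra.
Qed.

Lemma rV_rat_dense z (e : R) : 0 < e ->
  exists q : 'rV[rat]_m, `|z - map_mx ratr q| < e.
Proof.
move=> e0.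
have zo : open (ball z e) by exact: ball_open.
have := rV_open_countable_balls zo.
move=> /seteqP[+ _] => /(_ z (ballxx z e0))[[q k] /= qz _].
have k0 : 0 < k.+1%:R^-1 :> R by rewrite invr_gt0.
by exists q; have := qz _ (ballxx _ k0); rewrite -ball_normE.
Qed.

(** The minorants are the subgradient planes at the proximal points of rational [w] with integer
    weights [K]. For [w] near [z] and [K] large the proximal point is near [z], and its plane almost
    reaches [f z] at [z]. *)
Lemma convex_countable_minorants : exists h : nat -> 'rV[R]_m * R,
  (forall j z, affine (h j) z <= f z) /\
  forall z e, 0 < e -> exists j, f z - e < affine (h j) z.
Proof.
pose w (q : 'rV[rat]_m) : 'rV[R]_m := map_mx ratr q.
have Kgt0 (k : nat) : 0 < k.+1%:R :> R by [].
pose y qk := sval (cid (@convex_prox (w qk.1) qk.2.+1%:R (Kgt0 qk.2))).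
have yP qk : let v := w qk.1 - y qk in
    qk.2.+1%:R * dotr v v <= f (w qk.1) /\
    forall z, f (y qk) + 2 * qk.2.+1%:R * dotr v (z - y qk) <= f z.
  exact: (svalP (cid (@convex_prox (w qk.1) qk.2.+1%:R (Kgt0 qk.2)))).
pose g qk := let p := (2 * qk.2.+1%:R) *: (w qk.1 - y qk) in
  (p, f (y qk) - dotr p (y qk)).
have gE qk z : affine (g qk) z =
    f (y qk) + 2 * qk.2.+1%:R * dotr (w qk.1 - y qk) (z - y qk).
  rewrite /affine /g /= addrCA -dotrBr; congr (_ + _).
  by rewrite dotrC dotrZr dotrC.
(* Indices that decode to nothing yield the zero function, a minorant since [f] is non-negative. *)
exists (fun j => oapp g (0, 0) (unpickle j)); split.
  move=> j z; case: (unpickle j) => [qk|] /=; first by rewrite gE; apply (yP qk).2.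
  rewrite /affine /= addr0 /dotr big1// => i _.
  by rewrite mxE mul0r.
move=> z e e0.
have /cvgrPdist_lt/(_ (e / 2))/(_ _)/nbhs_ballP[|d /= d0 dz] := @f_cont z.
  by rewrite divr_gt0.
(* [c] will bound [f (w q)]. The weight [K] is taken so large that [K * |w q - y|^2 <= c] forces
   [|w q - y| <= d / 2]. *)
pose c := f z + e.
have c0 : 0 <= c / (d / 2) ^+ 2.
  by rewrite divr_ge0 ?sqr_ge0// addr_ge0// ltW.
pose k := Num.truncn (c / (d / 2) ^+ 2).
pose K : R := k.+1%:R.
have cK : c <= K * (d / 2) ^+ 2.
  rewrite -ler_pdivrMr ?exprn_gt0 ?divr_gt0//.
  by have /andP[_ /ltW] := truncn_itv c0.
have Kmd0 : 0 <= K * m%:R * d by rewrite !mulr_ge0// ltW.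
(* The first bound keeps the proximal point within [d] of [z]; the second makes the cross term, at
   most [K * m * d * |z - w q|], smaller than [e / 2]. *)
pose dl := Num.min (d / 2) (e / (2 * (K * m%:R * d + 1))).
have dl0 : 0 < dl.
  by rewrite lt_min !divr_gt0// mulr_gt0//; lra.
have [q zq] := rV_rat_dense z dl0.
have zqd : `|z - w q| < d / 2 by apply: lt_le_trans zq _; rewrite ge_min lexx.
have zqe : `|z - w q| * (2 * (K * m%:R * d + 1)) < e.
  rewrite -ltr_pdivlMr; last by lra.
  by apply: lt_le_trans zq _; rewrite ge_min lexx orbT.
have fw : f (w q) <= c.
  have /dz : ball z d (w q).
    by rewrite -ball_normE/=; lra.
  by rewrite /= distrC ltr_norml /c => /andP[_]; lra.
have [yw yz] := yP (q, k); rewrite /= in yw yz.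
have wy : `|w q - y (q, k)| <= d / 2.
  apply: normr_le_dotr; first by rewrite divr_ge0// ltW.
  by rewrite -(ler_pM2l (Kgt0 k)); apply: le_trans yw (le_trans fw cK).
have fy : f z - e / 2 < f (y (q, k)).
  have /dz : ball z d (y (q, k)).
    rewrite -ball_normE/=.
    have := ler_distD (w q) z (y (q, k)); lra.
  by rewrite /= ltr_norml => /andP[_]; lra.
exists (pickle (q, k)); rewrite pickleK /= gE /=.
(* The part along [w q - y] contributes a non-negative square, so only the part along [z - w q] has
   to be small. *)
have -> : z - y (q, k) = (w q - y (q, k)) + (z - w q) by rewrite [RHS]addrC subrKA.
have b_ge := normr_dotr_le (w q - y (q, k)) (z - w q).
have a_ge := dotr_ge0 (w q - y (q, k)).
rewrite dotrDr mulrDr.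
have Ka : 0 <= 2 * k.+1%:R * dotr (w q - y (q, k)) (w q - y (q, k)).
  by rewrite mulr_ge0// mulr_ge0.
have Kb : 2 * k.+1%:R * `|dotr (w q - y (q, k)) (z - w q)| <=
    K * m%:R * d * `|z - w q|.
  apply: le_trans (ler_wpM2l _ b_ge) _; first by rewrite mulr_ge0.
  rewrite (_ : K * m%:R * d * _ = 2 * k.+1%:R * (m%:R * (d / 2 * `|z - w q|))).
    by do 2 (apply: ler_wpM2l; first by rewrite ?mulr_ge0); exact: ler_wpM2r.
  by rewrite /K; field.
move: Kb; rewrite -[2 * _]ger0_norm ?mulr_ge0// -normrM.
rewrite ler_norml => /andP[+ _].
rewrite ger0_norm ?mulr_ge0//.
have := normr_ge0 (z - w q); lra.
Qed.

End convex_minorants.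

(** * Null sets and completion-measurable functions *)

Section null_sets.
Context d (T : measurableType d) (R : realType) (mu : {measure set T -> \bar R}).

Definition null N := measurable N /\ mu N = 0%E.

Lemma null_bigcup (I : countType) (N : I -> set T) :
  (forall i, null (N i)) -> null (\bigcup_i N i).
Proof.
move=> N0; split.
  by apply: countable_bigcupT_measurable => // i; have [] := N0 i.
apply: measure_negligible.
  by apply: countable_bigcupT_measurable => // i; have [] := N0 i.
apply: (@negligibleS _ _ _ mu (\bigcup_k oapp N set0 (unpickle k))).
  by move=> x [i _ Nx]; exists (pickle i) => //; rewrite pickleK.
apply: negligible_bigcup => k.
case: (unpickle k) => [i|] /=; last exact: negligible_set0.
by have [mN Ni0] := N0 i; apply/negligibleP.
Qed.

Lemma null_setU N1 N2 : null N1 -> null N2 -> null (N1 `|` N2).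
Proof.
move=> [mN1 N10] [mN2 N20]; split; first exact: measurableU.
apply: measure_negligible; first exact: measurableU.
by apply: negligibleU; apply/negligibleP.
Qed.

Import HBNNSimple.

Let nnintegral_le (g g' : T -> \bar R) (N : set T) : null N ->
  (forall x, (0 <= g' x)%E) -> (forall x, ~ N x -> g x = g' x) ->
  (ereal_sup [set sintegral mu h |
      h in [set h : {nnsfun T >-> R} | forall x, ((h x)%:E <= g x)%E]] <=
  ereal_sup [set sintegral mu h |
      h in [set h : {nnsfun T >-> R} | forall x, ((h x)%:E <= g' x)%E]])%E.
Proof.
move=> [mN N0] g'0 gg'; apply: ge_ereal_sup => _ [h /= hg <-].
apply: ereal_sup_ubound.
exists (mul_nnsfun h (indic_nnsfun R (measurableC mN))) => [x /=|].
  rewrite mindicE; have [xN|xN] := boolP (x \in N).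
    by rewrite in_setC xN mulr0.
  by rewrite in_setC xN mulr1 -gg' ?hg// -notin_setE.
rewrite -!integralT_nnsfun; apply: ae_eq_integral => //.
- by apply/measurable_EFinP.
- by apply/measurable_EFinP.
exists N; split => // x /= /not_implyP[_]; apply: contra_notP => xN.
by rewrite mindicE in_setC memNset// mulr1.
Qed.

(* [f] need not be measurable: the library integral is a supremum over simple
   functions, which can be cut off on a null set. *)
Lemma integral_setD_null (D N : set T) (f : T -> \bar R) : null N ->
  (\int[mu]_(x in D) f x = \int[mu]_(x in D `\` N) f x)%E.
Proof.
move=> N0; rewrite /integral.
have fE x : ~ N x -> (f \_ D) x = (f \_ (D `\` N)) x.
  by move=> Nx; rewrite /patch in_setD (memNset Nx) andbT.
by congr (_ - _)%E; apply/eqP; rewrite eq_le; apply/andP; split;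
  apply: (nnintegral_le N0) => x;
  rewrite ?funepos_ge0 ?funeneg_ge0// => Nx; rewrite ?funeposE ?funenegE fE.
Qed.

Lemma Rintegral_setD_null (D N : set T) (f : T -> R) : null N ->
  \int[mu]_(x in D) f x = \int[mu]_(x in D `\` N) f x.
Proof. by move=> N0; rewrite /Rintegral (integral_setD_null _ _ N0). Qed.

(** For each rational [q] the superlevel set of [h] at [q] is measurable up to a null set. Off the
    countable union of these null sets, every superlevel set is a union of rational ones. *)
Lemma mu_measurable_null D (h : T -> R) : measurable D ->
  mu_measurable mu D h -> exists2 N, null N & measurable_fun (D `\` N) h.
Proof.
move=> mD mh.
have H (q : rat) : {AM : set T * set T | [/\ measurable AM.1, null AM.2 &
    forall x, ~ AM.2 x -> (AM.1 x <-> D x /\ ratr q < h x)]}.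
  apply: cid.
  have [A mA [N0 [N [mN NN NN0]] AE]] := mh `]ratr q, +oo[%classic (measurable_itv _).
  exists (A, N); split => //= x Nx.
  have : (A `|` N0) x <-> D x /\ ratr q < h x.
    by rewrite AE /= in_itv/= andbT.
  move=> <-; split; first by left.
  by move=> [//|/NN0].
pose N := \bigcup_q (sval (H q)).2.
have N0 : null N.
  by apply: null_bigcup => q; have [] := svalP (H q).
exists N => //.
have mDN : measurable (D `\` N) by apply: measurableD => //; exact: N0.1.
apply: (measurability _ (RGenOInfty.measurableE R)).
move=> _ [_ [r ->] <-].
rewrite (_ : _ `&` _ = \bigcup_(q : rat)
   ((D `\` N) `&` if r < ratr q then (sval (H q)).1 else set0)).
  apply: countable_bigcupT_measurable => // q; apply: measurableI => //.
  by case: ifPn => // _; have [] := svalP (H q).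
apply/seteqP; split => x.
  move=> [DNx] /=; rewrite in_itv/= andbT => rh.
  have [q /andP[rq qh]] : exists q : rat, r < ratr q < h x.
    have [q] := rat_in_itvoo rh; rewrite in_itv/= => qP.
    by exists q.
  exists q => //; split => //; rewrite rq.
  have [_ _ /(_ x)] := svalP (H q).
  move=> ->; first by split => //; case: DNx.
  by case: DNx => _ Nx Nq; apply: Nx; exists q.
move=> [q _ [DNx]]; case: ifPn => // rq Ax; split => //=.
rewrite in_itv/= andbT; apply: lt_trans rq _.
have [_ _ /(_ x)] := svalP (H q).
move=> []; last by move=> /(_ Ax)[].
by case: DNx => _ Nx Nq; apply: Nx; exists q.
Qed.

End null_sets.

(** * The squared Euclidean norm *)

Section enorm.
Context {R : realType} {m : nat}.
Implicit Type z : 'rV[R]_m.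

Lemma enorm2E z : enorm z ^+ 2 = dotr z z.
Proof.
rewrite sqr_sqrtr; first by apply: eq_bigr => i _; rewrite expr2.
by apply: sumr_ge0 => i _; exact: sqr_ge0.
Qed.

Lemma continuous_enorm2 : continuous (fun z => enorm z ^+ 2).
Proof.
rewrite (_ : (fun z => _) = (fun z : 'rV[R]_m => dotr (0 - z) (0 - z))).
  exact: continuous_dotr_sub.
apply/funext => z; rewrite enorm2E sub0r /dotr; apply: eq_bigr => i _.
by rewrite mxE mulrNN.
Qed.

Lemma measurable_enorm2 : measurable_fun setT (fun z => enorm z ^+ 2).
Proof. by apply: continuous_measurable_rV_fun; exact: continuous_enorm2. Qed.

Lemma coord2_le z i : z 0 i ^+ 2 <= enorm z ^+ 2.
Proof.
rewrite enorm2E /dotr (bigD1 i)//= expr2 lerDl.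
by apply: sumr_ge0 => k _; rewrite -expr2 sqr_ge0.
Qed.

Lemma enorm2Z s z : enorm (s *: z) ^+ 2 = s ^+ 2 * enorm z ^+ 2.
Proof.
by rewrite !enorm2E dotrZr dotrC dotrZr mulrA expr2.
Qed.

End enorm.

(** * Moments of the oscillation measure *)

Section clip.
Context {R : realType}.

(** Truncation to the interval from [-k] to [k]. Weak measurability of a Young measure speaks of
    bounded integrands only; unbounded ones are reached as limits of their truncations. *)
Definition clip (k : nat) (t : R) := Num.max (- k%:R) (Num.min t k%:R).

Lemma norm_clip_le k t : `|clip k t| <= k%:R.
Proof.
have k0 : 0 <= k%:R :> R by [].
by rewrite ler_norml /clip le_max lexx/= ge_max ge_min lexx orbT andbT; lra.
Qed.

Lemma norm_clip_ler k t : `|clip k t| <= `|t|.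
Proof.
have k0 : 0 <= k%:R :> R by [].
have tt : - `|t| <= t by rewrite lerNl -normrN ler_norm.
have t0 := normr_ge0 t.
rewrite ler_norml /clip le_max le_min ge_max ge_min ler_norm tt /= andbT.
by apply/andP; split; [apply/orP; right|]; lra.
Qed.

Lemma clip_id k t : `|t| <= k%:R -> clip k t = t.
Proof.
rewrite ler_norml => /andP[kt tk].
by rewrite /clip (min_idPl tk) (max_idPr kt).
Qed.

Lemma clip_homo k l t : 0 <= t -> (k <= l)%N -> clip k t <= clip l t.
Proof.
move=> t0 kl; rewrite /clip ge_max !le_max !le_min !ge_min lexx/=.
have kl' : k%:R <= l%:R :> R by rewrite ler_nat.
have k0 : 0 <= k%:R :> R by [].
by rewrite kl' orbT/= orbT andbT; apply/orP; right; apply/andP; split; lra.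
Qed.

Lemma cvg_clip t : clip k t @[k --> \oo] --> t.
Proof.
apply: cvg_near_cst; near=> k; apply: clip_id.
by near: k; exact: nbhs_infty_ger.
Unshelve. all: by end_near. Qed.

Lemma measurable_clip k d (T : measurableType d) D (f : T -> R) :
  measurable_fun D f -> measurable_fun D (clip k \o f).
Proof.
by move=> mf; apply: measurable_maxr => //; apply: measurable_minr.
Qed.

End clip.

Lemma bounded_integrable_probability {R : realType} d (T : measurableType d)
    (P : probability T R) (g : T -> R) (C : R) :
  measurable_fun setT g -> (forall z, `|g z| <= C) ->
  P.-integrable setT (EFin \o g).
Proof.
move=> mg gC; apply: measurable_bounded_integrable => //.
  by rewrite -ge0_fin_numE// fin_num_measure.
exists C; split; first exact: num_real.
by move=> r Cr z _ /=; exact: le_trans (gC z) (ltW Cr).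
Qed.

Lemma Rintegral_dominated_cvg {R : realType} d (T : measurableType d)
    (mu : {measure set T -> \bar R}) (D : set T) (f_ : nat -> T -> R)
    (f g : T -> R) : measurable D ->
  (forall k, measurable_fun D (f_ k)) ->
  (forall x, D x -> f_ k x @[k --> \oo] --> f x) ->
  mu.-integrable D (EFin \o g) ->
  (forall k x, D x -> `|f_ k x| <= g x) ->
  mu.-integrable D (EFin \o f) /\
  \int[mu]_(x in D) f_ k x @[k --> \oo] --> \int[mu]_(x in D) f x.
Proof.
move=> mD mf_ f_f ig fg.
have mf : measurable_fun D f := measurable_fun_cvg mf_ f_f.
have [||||intf _ cf] := @dominated_convergence _ _ _ mu D mD
    (fun k => EFin \o f_ k) (EFin \o f) (EFin \o g) _ _ _ ig.
- by move=> k; apply/measurable_EFinP.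
- exact/measurable_EFinP.
- by apply: aeW => x Dx; apply: cvg_EFin; [exact: nearW|exact: f_f].
- by apply: aeW => x k Dx; rewrite lee_fin fg.
split=> //; apply: fine_cvg; rewrite fineK//.
exact: integrable_fin_num.
Qed.

Section moments.
Context {R : realType} {n m : nat}.
Variables (Omega : set 'rV[R]_n) (Y : @young_triple R n m).
Notation L := (@lebesgue_rV R n).
Hypotheses (Omega_open : open Omega) (Omega_bounded : bounded_set Omega).
Hypothesis Yyoung : gen_young Omega Y.

Lemma lebesgue_rV_bounded : (L Omega < +oo)%E.
Proof.
have [M [Mreal MO]] := Omega_bounded.
have {}MO x : Omega x -> `|x| <= M + 1 by apply: MO; rewrite ltrDl.
(* The boxes are open on the left, so their half-width exceeds the bound [M + 1] strictly. *)
pose a : 'rV[R]_n := const_mx (- (M + 2)); pose b : 'rV[R]_n := const_mx (M + 2).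
have [->|/set0P[x0 Ox0]] := eqVneq Omega set0; first by rewrite measure0.
have M0 : 0 <= M + 1 by apply: le_trans (MO _ Ox0).
apply: (@le_lt_trans _ _ (L [set x | forall j, a 0 j < x 0 j <= b 0 j])).
  apply: le_measure; rewrite ?inE//; first exact: open_measurable_rV.
    exact: measurable_box_rV.
  move=> x /MO xM j; rewrite !mxE.
  have := le_trans (normr_coord_le x j) xM; rewrite ler_norml; lra.
by rewrite lebesgue_rV_box ?ltry// => j; rewrite !mxE; lra.
Qed.

Lemma measurable_Omega : measurable Omega.
Proof. exact: open_measurable_rV. Qed.

Lemma oscillation_bounded (g : 'rV[R]_m -> R) (C : R) :
  measurable_fun setT g -> (forall z, `|g z| <= C) ->
  exists2 N, null L N &
    measurable_fun (Omega `\` N) (fun x => \int[oscillation Y x]_z g z).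
Proof.
move=> mg gC; have [[_ Ymeas] _ _ _] := Yyoung.
apply: mu_measurable_null; first exact: measurable_Omega.
apply: Ymeas => //; exists C; split; first exact: num_real.
by move=> r Cr z _ /=; exact: le_trans (gC z) (ltW Cr).
Qed.

Lemma oscillation_clip (g : 'rV[R]_m -> R) : measurable_fun setT g ->
  exists2 N, null L N & forall k : nat,
    measurable_fun (Omega `\` N) (fun x => \int[oscillation Y x]_z clip k (g z)).
Proof.
move=> mg.
have H k := cid2 (@oscillation_bounded (clip k \o g) k%:R
  (measurable_clip k mg) (fun z => norm_clip_le k (g z))).
pose N := \bigcup_k (s2val (H k)); exists N.
  by apply: null_bigcup => k; exact: (s2valP (H k)).
move=> k; apply: measurable_funS (s2valP' (H k)).
  by apply: measurableD; [exact: measurable_Omega|exact: (s2valP (H k)).1].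
by apply: setDS => x Nx; exists k.
Qed.

(** The extended-valued moment is a monotone limit of truncated moments, hence measurable off a null
    set, and its integral is finite by the definition of a generalized Young measure. It is
    therefore finite almost everywhere, where it agrees with the real-valued integral. *)
Lemma oscillation_second_moment : exists2 N, null L N &
  (forall x, (Omega `\` N) x ->
    (oscillation Y x).-integrable setT (EFin \o (fun z => enorm z ^+ 2))) /\
  L.-integrable (Omega `\` N)
    (EFin \o (fun x => \int[oscillation Y x]_z (enorm z ^+ 2))).
Proof.
have [_ _ _ Yfin] := Yyoung.
pose q (z : 'rV[R]_m) := enorm z ^+ 2.
have q0 z : 0 <= q z by rewrite sqr_ge0.
have mq : measurable_fun setT q := @measurable_enorm2 R m.
have [N N0 mN] := oscillation_clip mq.
have mON : measurable (Omega `\` N).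
  by apply: measurableD; [exact: measurable_Omega|exact: N0.1].
pose E x := (\int[oscillation Y x]_z (q z)%:E)%E.
have E0 x : (0 <= E x)%E by apply: integral_ge0 => z _; rewrite lee_fin.
have clip_ge0 k z : 0 <= clip k (q z).
  by rewrite /clip le_max le_min q0 ler0n orbT.
have mE : measurable_fun (Omega `\` N) E.
  apply: (@emeasurable_fun_cvg _ _ _ _
    (fun k x => (\int[oscillation Y x]_z clip k (q z))%:E)).
    by move=> k; apply/measurable_EFinP.
  move=> x ONx.
  rewrite (_ : (fun k => _) =
      fun k => \int[oscillation Y x]_z (clip k (q z))%:E)%E; last first.
    apply/funext => k; rewrite /Rintegral fineK//.
    apply: integrable_fin_num => //.
    apply: (@bounded_integrable_probability _ _ _ _ (clip k \o q) k%:R).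
      exact: measurable_clip.
    by move=> z; exact: norm_clip_le.
  rewrite (_ : E x = \int[oscillation Y x]_z limn (fun k => (clip k (q z))%:E))%E.
    apply: (@cvg_monotone_convergence _ _ _ (oscillation Y x) setT measurableT
      (fun k z => (clip k (q z))%:E)) => //=.
    - by move=> k; apply/measurable_EFinP/measurable_clip.
    - by move=> k z _; rewrite lee_fin.
    - by move=> z _ k l kl; rewrite lee_fin clip_homo.
  apply: eq_integral => z _; apply/esym/cvg_lim => //.
  by apply: cvg_EFin; [exact: nearW|exact: cvg_clip].
have iE : L.-integrable (Omega `\` N) E.
  apply/integrableP; split => //.
  rewrite (eq_integral E) => [|x _]; last by rewrite gee0_abs.
  rewrite -(integral_setD_null Omega E N0).
  apply: le_lt_trans Yfin; exact: leeDl.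
(* [N'] absorbs the points with infinite second moment. *)
have [N' [mN' N'0 N'P]] := integrable_ae mON iE.
have N'E x : (Omega `\` (N `|` N')) x -> E x \is a fin_num.
  move=> [Ox /not_orP[Nx N'x]]; apply: contrapT => Ex; apply: N'x.
  by apply: N'P => /= H; apply: Ex; exact: H.
have mONN' : measurable (Omega `\` (N `|` N')).
  apply: measurableD; first exact: measurable_Omega.
  by apply: measurableU => //; exact: N0.1.
exists (N `|` N'); first by apply: null_setU.
split=> [x /N'E Ex|].
  apply/integrableP; split; first by apply/measurable_EFinP.
  rewrite (_ : integral _ _ _ = E x); first by rewrite -ge0_fin_numE// integral_ge0.
  by apply: eq_integral => z _; rewrite gee0_abs// /= lee_fin sqr_ge0.
apply: (@eq_integrable _ _ _ _ _ _ E) => //.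
  by move=> x xO; rewrite /= /Rintegral fineK//; apply: N'E; apply/set_mem.
apply: integrableS iE => //.
by apply: setDS => x; left.
Qed.

(** Measurability in [x] comes from truncation and dominated convergence, integrability from
    comparison with the second moment; the constant 1 is integrable because [Omega] is bounded. *)
Lemma oscillation_integrable (g : 'rV[R]_m -> R) (C : R) : measurable_fun setT g ->
  (forall z, `|g z| <= C * (1 + enorm z ^+ 2)) ->
  exists2 N, null L N &
  (forall x, (Omega `\` N) x ->
    (oscillation Y x).-integrable setT (EFin \o g)) /\
  L.-integrable (Omega `\` N) (EFin \o (fun x => \int[oscillation Y x]_z g z)).
Proof.
move=> mg gC.
have [N1 N10 [q1 iq]] := oscillation_second_moment.
have [N2 N20 mN2] := oscillation_clip mg.
have N0 := null_setU N10 N20.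
pose D := Omega `\` (N1 `|` N2).
have mD : measurable D.
  by apply: measurableD; [exact: measurable_Omega|exact: N0.1].
have D1 : D `<=` Omega `\` N1 by apply: setDS => x; left.
have D2 : D `<=` Omega `\` N2 by apply: setDS => x; right.
have mO k : null L k -> measurable (Omega `\` k).
  by move=> k0; apply: measurableD; [exact: measurable_Omega|exact: k0.1].
have LD : (L D < +oo)%E.
  apply: le_lt_trans lebesgue_rV_bounded; apply: le_measure; rewrite ?inE//.
  - exact: measurable_Omega.
  - exact: subDsetl.
have i1q x : D x -> (oscillation Y x).-integrable setT
    (EFin \o (fun z => 1 + enorm z ^+ 2)).
  move=> Dx; apply: (@integrableD _ _ _ (oscillation Y x) setT measurableT
    (EFin \o cst 1) (EFin \o (fun z => enorm z ^+ 2))).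
    exact: finite_measure_integrable_cst.
  by apply: q1; exact: D1.
have iCq x : D x -> (oscillation Y x).-integrable setT
    (EFin \o (fun z => C * (1 + enorm z ^+ 2))).
  move=> Dx; apply: (@integrableZl _ _ _ (oscillation Y x) setT measurableT C
    (EFin \o (fun z => 1 + enorm z ^+ 2))).
  exact: i1q.
have gi x : D x -> (oscillation Y x).-integrable setT (EFin \o g).
  move=> Dx; apply: le_integrable (iCq _ Dx) => //; first exact/measurable_EFinP.
  by move=> z _; rewrite !lee_fin; apply: le_trans (gC z) (ler_norm _).
exists (N1 `|` N2) => //; split => //.
have mgD : measurable_fun D (fun x => \int[oscillation Y x]_z g z).
  apply: (@measurable_fun_cvg _ _ _ _
    (fun k x => \int[oscillation Y x]_z clip k (g z))).
    by move=> k; apply: measurable_funS (mN2 k) => //; exact: mO.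
  move=> x Dx.
  apply: (@Rintegral_dominated_cvg _ _ _ (oscillation Y x) setT
    (fun k => clip k \o g) g (Num.norm \o g) _ _ _ _ _).2 => //.
  - by move=> k; exact: measurable_clip.
  - by move=> z _; exact: cvg_clip.
  - by apply: integrable_norm; exact: gi.
  - by move=> k z _; exact: norm_clip_ler.
have iD : L.-integrable D
    (EFin \o (fun x => C * (1 + \int[oscillation Y x]_z (enorm z ^+ 2)))).
  apply: (@integrableZl _ _ _ _ D mD C
    (EFin \o (fun x => 1 + \int[oscillation Y x]_z (enorm z ^+ 2)))).
  apply: (@integrableD _ _ _ _ D mD
    (EFin \o cst 1) (EFin \o (fun x => \int[oscillation Y x]_z (enorm z ^+ 2)))).
    apply: measurable_bounded_integrable => //.
    exists 1; split; first exact: num_real.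
    by move=> r r1 x _ /=; rewrite normr1 ltW.
  by apply: integrableS iq => //; exact: mO.
apply: le_integrable iD => //; first exact/measurable_EFinP.
move=> x Dx; rewrite !lee_fin.
apply: le_trans (le_normr_Rintegral _ (gi x Dx)) _ => //.
apply: le_trans (ler_norm _).
have -> : C * (1 + \int[oscillation Y x]_z (enorm z ^+ 2)) =
    \int[oscillation Y x]_z (C * (1 + enorm z ^+ 2)).
  rewrite (@RintegralZl _ _ _ (oscillation Y x) setT (fun z => 1 + enorm z ^+ 2))//; last first.
    by apply: i1q.
  rewrite (@RintegralD _ _ _ (oscillation Y x) setT (cst 1))//.
  - rewrite Rintegral_cst//= mul1r.
    by have -> : fine (oscillation Y x setT) = 1 by rewrite probability_setT.
  - exact: finite_measure_integrable_cst.
  - by apply: q1; exact: D1.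
apply: le_Rintegral => //; last exact: iCq.
by apply: integrable_norm; exact: gi.
Qed.

End moments.

(** * Weak convergence tested on Borel sets *)

Section distance.
Context {R : realType} {V : normedModType R}.
Variable A : set V.
Hypothesis A0 : A !=set0.

Definition setdist (x : V) : R := inf [set `|x - a| | a in A].

Let has_inf_dist x : has_inf [set `|x - a| | a in A].
Proof.
split; first by have [a Aa] := A0; exists `|x - a|; exists a.
by exists 0 => _ [a _ <-].
Qed.

Lemma setdist_le x a : A a -> setdist x <= `|x - a|.
Proof. by move=> Aa; apply: ge_inf; [exact: (has_inf_dist x).2|exists a]. Qed.

Lemma setdist_ge x e : (forall a, A a -> e <= `|x - a|) -> e <= setdist x.
Proof.
by move=> xe; apply: lb_le_inf => [|_ [a Aa <-]]; [exact: (has_inf_dist x).1|exact: xe].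
Qed.

Lemma setdist_ge0 x : 0 <= setdist x.
Proof. exact: setdist_ge. Qed.

Lemma setdist0 x : A x -> setdist x = 0.
Proof.
move=> Ax; apply/eqP; rewrite eq_le setdist_ge0 andbT.
by have := setdist_le x Ax; rewrite subrr normr0.
Qed.

Lemma setdist_lipschitz x y : `|setdist x - setdist y| <= `|x - y|.
Proof.
have H u v : setdist u - `|u - v| <= setdist v.
  apply: setdist_ge => a Aa; rewrite lerBlDr.
  by rewrite addrC; apply: le_trans (ler_distD v u a); exact: setdist_le.
rewrite ler_norml; have := H x y; have := H y x; rewrite (distrC y x); lra.
Qed.

Lemma continuous_setdist : continuous setdist.
Proof.
move=> x; apply/cvgrPdist_lt => e e0; near=> y.
apply: le_lt_trans (setdist_lipschitz _ _) _.
by near: y; apply: cvgr_dist_lt => //; exact: cvg_id.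
Unshelve. all: by end_near. Qed.

Lemma setdist_gt0 x : closed A -> ~ A x -> 0 < setdist x.
Proof.
move=> /closed_openC; rewrite openE => oA Ax.
have /nbhs_ballP[e /= e0 xeA] := oA x Ax.
apply: lt_le_trans e0 _; apply: setdist_ge => a Aa; rewrite leNgt.
by apply/negP => xa; apply: (xeA a) => //; rewrite -ball_normE.
Qed.

End distance.

(** Multiples of the distance to the complement, cut at 1, increase to the indicator. *)
Lemma open_indic_cvg {R : realType} n (U : set 'rV[R]_n) : open U ->
  exists phi : nat -> 'rV[R]_n -> R,
    [/\ forall j, continuous (phi j), forall j x, 0 <= phi j x <= 1 &
        forall x, phi j x @[j --> \oo] --> (\1_U x : R)].
Proof.
move=> oU.
(* The distance to an empty complement would be the infimum of an empty set, so the whole space is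
   treated apart. *)
have [A0|/set0P A0] := eqVneq (~` U) set0.
  have -> : U = setT by rewrite -[U]setCK A0 setC0.
  exists (fun _ _ => 1); split => [j|j x|x]; first exact: cst_continuous.
    by rewrite ler01 lexx.
  by rewrite indicE in_setT; exact: cvg_cst.
exists (fun j x => Num.min 1 (j%:R * setdist (~` U) x)); split => [j x|j x|x].
- apply: (@continuous_min _ _ (cst 1) (fun x => j%:R * setdist (~` U) x) x).
    exact: cst_continuous.
  apply: continuousM; first exact: cst_continuous.
  exact: continuous_setdist.
- by rewrite le_min ler01 ge_min lexx !andbT/= mulr_ge0// setdist_ge0.
- rewrite indicE; have [xU|xU] := boolP (x \in U); last first.
    rewrite setdist0//; last by move: xU; rewrite notin_setE.
    under eq_cvg do rewrite mulr0 (min_idPr ler01).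
    exact: cvg_cst.
  have d0 : 0 < setdist (~` U) x.
    apply: setdist_gt0 => //; first by rewrite closedC.
    by apply; rewrite inE in xU.
  apply: cvg_near_cst; near=> j; apply/min_idPl.
  rewrite -ler_pdivrMr//.
  by near: j; exact: nbhs_infty_ger.
Unshelve. all: by end_near. Qed.

Section tested.
Context {R : realType} d (T : measurableType d).
Variables (mu : {measure set T -> \bar R}) (D : set T).
Hypotheses (mD : measurable D) (muD : (mu D < +oo)%E).

Lemma integrable_bounded_fun (psi : T -> R) (C : R) : measurable_fun D psi ->
  (forall x, D x -> `|psi x| <= C) -> mu.-integrable D (EFin \o psi).
Proof.
move=> mpsi psiC; apply: measurable_bounded_integrable => //.
exists C; split; first exact: num_real.
by move=> r Cr z Dz /=; exact: le_trans (psiC z Dz) (ltW Cr).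
Qed.

Lemma integrable_mul_bounded (psi v : T -> R) : measurable_fun D psi ->
  (forall x, D x -> `|psi x| <= 1) -> mu.-integrable D (EFin \o v) ->
  mu.-integrable D (EFin \o (fun x => psi x * v x)).
Proof.
move=> mpsi psi1 iv; have mv : measurable_fun D v.
  by apply/measurable_EFinP; exact: measurable_int iv.
apply: le_integrable iv => //; first exact/measurable_EFinP/measurable_funM.
move=> x Dx; rewrite !lee_fin normrM ler_piMl//; exact: psi1.
Qed.

(* Uniform integrability in quantitative form: a bound on [u ^ 2] by [G] enters
   as [`|u| <= delta^-1 + delta * G] for all [delta]. *)
Lemma test_error (psi phi v G : T -> R) (C delta : R) : 0 < delta ->
  measurable_fun D psi -> measurable_fun D phi ->
  (forall x, D x -> `|psi x| <= 1) -> (forall x, D x -> `|phi x| <= 1) ->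
  mu.-integrable D (EFin \o v) -> mu.-integrable D (EFin \o G) ->
  (forall x, D x -> 0 <= G x) -> \int[mu]_(x in D) G x <= C ->
  (forall x, D x -> `|v x| <= delta^-1 + delta * G x) ->
  `|\int[mu]_(x in D) (psi x * v x) - \int[mu]_(x in D) (phi x * v x)| <=
  delta^-1 * \int[mu]_(x in D) `|psi x - phi x| + 2 * delta * C.
Proof.
move=> d0 mpsi mphi psi1 phi1 iv iG G0 GC vG.
have idiff : mu.-integrable D (EFin \o (fun x => `|psi x - phi x|)).
  apply: (@integrable_bounded_fun _ 2).
    by apply: measurableT_comp => //; exact: measurable_funB.
  move=> x Dx; rewrite normr_id; apply: le_trans (ler_normB _ _) _.
  have := psi1 x Dx; have := phi1 x Dx; lra.
have i1 := integrable_mul_bounded mpsi psi1 iv.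
have i2 := integrable_mul_bounded mphi phi1 iv.
have i3 := integrableZl mD delta^-1 idiff.
have i4 := integrableZl mD (2 * delta) iG.
rewrite -RintegralB//.
apply: (le_trans (le_normr_Rintegral mD _)).
  exact: (integrableB mD i1 i2).
apply: (@le_trans _ _ (delta^-1 * \int[mu]_(x in D) `|psi x - phi x| +
    2 * delta * \int[mu]_(x in D) G x)); last first.
  by rewrite lerD2l ler_wpM2l// mulr_ge0// ltW.
rewrite -!RintegralZl// -RintegralD//.
apply: le_Rintegral => //.
- by apply: integrable_norm; exact: (integrableB mD i1 i2).
- exact: (integrableD mD i3 i4).
move=> x Dx; rewrite -mulrBl normrM.
have p2 : `|psi x - phi x| <= 2.
  apply: le_trans (ler_normB _ _) _.
  have := psi1 x Dx; have := phi1 x Dx; lra.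
apply: le_trans (ler_wpM2l (normr_ge0 _) (vG x Dx)) _.
rewrite mulrDr mulrC lerD2l mulrA mulrAC.
rewrite mulrAC ler_wpM2r ?G0// ler_wpM2r// ltW//.
Qed.

Variables (u_ G_ : nat -> T -> R) (u G : T -> R) (C : R).
Hypothesis iu_ : forall k, mu.-integrable D (EFin \o u_ k).
Hypothesis iu : mu.-integrable D (EFin \o u).
Hypothesis iG_ : forall k, mu.-integrable D (EFin \o G_ k).
Hypothesis iG : mu.-integrable D (EFin \o G).
Hypothesis G_0 : forall k x, D x -> 0 <= G_ k x.
Hypothesis G0 : forall x, D x -> 0 <= G x.
Hypothesis G_C : forall k, \int[mu]_(x in D) G_ k x <= C.
Hypothesis GC : \int[mu]_(x in D) G x <= C.
Hypothesis uG_ : forall k x delta, D x -> 0 < delta ->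
  `|u_ k x| <= delta^-1 + delta * G_ k x.
Hypothesis uG : forall x delta, D x -> 0 < delta ->
  `|u x| <= delta^-1 + delta * G x.

Definition tested (psi : T -> R) :=
  \int[mu]_(x in D) (psi x * u_ k x) @[k --> \oo] -->
  \int[mu]_(x in D) (psi x * u x).

(** By [test_error], replacing [psi] by [psi_ j] costs an amount independent of [k], and the L1
    distance of the two tends to 0 by dominated convergence. The order of choice is [delta], then
    [j], then [k]. *)
Lemma tested_lim (psi_ : nat -> T -> R) (psi : T -> R) :
  (forall j, measurable_fun D (psi_ j)) ->
  (forall j x, D x -> `|psi_ j x| <= 1) ->
  (forall x, D x -> psi_ j x @[j --> \oo] --> psi x) ->
  (forall j, tested (psi_ j)) -> tested psi.
Proof.
move=> mpsi_ psi_1 psi_psi tpsi_.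
have mpsi : measurable_fun D psi := measurable_fun_cvg mpsi_ psi_psi.
have psi1 x : D x -> `|psi x| <= 1.
  move=> Dx; have /cvg_norm := psi_psi x Dx.
  move=> H; have /cvg_lim <- // := H.
  apply: limr_le; first by apply/cvg_ex; eexists; exact: H.
  by apply: nearW => j; exact: psi_1.
apply/cvgrPdist_lt => e e0.
have C0 : 0 <= C by apply: le_trans GC; apply: Rintegral_ge0.
(* Each replacement error is at most [e / 16 + e / 4]. Two of them and the error [e / 16] for
   [psi_ j] remain below [e]; [C + 1] keeps the denominator positive when [C] is 0. *)
pose delta := e / (8 * (C + 1)).
have d0 : 0 < delta by rewrite divr_gt0//; lra.
have dC : 2 * delta * C <= e / 4.
  have : delta * (8 * (C + 1)) = e by rewrite /delta; field; lra.
  nra.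
have : \int[mu]_(x in D) `|psi x - psi_ j x| @[j --> \oo] --> (0 : R).
  rewrite -[X in _ --> X](_ : \int[mu]_(x in D) cst 0 x = 0); last first.
    by rewrite Rintegral_cst// mul0r.
  apply: (@Rintegral_dominated_cvg _ _ _ mu D _ _ (cst 2) _ _ _ _ _).2 => //.
  - move=> j; apply: measurableT_comp => //; exact: measurable_funB.
  - move=> x Dx; rewrite -[X in _ --> X](@normr0 _ R) -[X in `|X|](subrr (psi x)).
    apply: cvg_norm; apply: cvgB; [exact: cvg_cst|exact: psi_psi].
  - apply: (@integrable_bounded_fun _ 2) => // x _; rewrite ger0_norm//.
  - move=> j x Dx; rewrite normr_id; apply: le_trans (ler_normB _ _) _.
    have := psi1 x Dx; have := psi_1 j x Dx; rewrite /=; lra.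
move=> /cvgrPdist_lt/(_ (delta * (e / 16)))[].
  by rewrite mulr_gt0// divr_gt0.
move=> j _ /(_ j (leqnn j)) /=; rewrite sub0r normrN.
rewrite ger0_norm; last by apply: Rintegral_ge0.
move=> small.
have {}small : delta^-1 * \int[mu]_(x in D) `|psi x - psi_ j x| <= e / 16.
  by rewrite -ler_pdivlMl ?invr_gt0// invrK ltW.
have err0 := test_error d0 mpsi (mpsi_ j) psi1 (psi_1 j) iu iG G0 GC
  (fun x Dx => uG Dx d0).
have errk k := test_error d0 mpsi (mpsi_ j) psi1 (psi_1 j) (iu_ k) (iG_ k)
  (G_0 k) (G_C k) (fun x Dx => uG_ k Dx d0).
have := tpsi_ j; rewrite /tested => /cvgrPdist_lt/(_ (e / 16)).
rewrite divr_gt0// => /(_ isT); apply: filterS => k tk.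
have := errk k; move: err0 tk.
set a := \int[mu]_(x in D) (psi x * u x).
set b := \int[mu]_(x in D) (psi_ j x * u x).
set a' := \int[mu]_(x in D) (psi x * u_ k x).
set b' := \int[mu]_(x in D) (psi_ j x * u_ k x).
rewrite !ler_norml !ltr_norml; lra.
Qed.

Lemma tested_indicP A : measurable A -> tested \1_A ->
  \int[mu]_(x in D `&` A) u_ k x @[k --> \oo] --> \int[mu]_(x in D `&` A) u x.
Proof.
move=> mA; rewrite /tested.
have E v : \int[mu]_(x in D) (\1_A x * v x) = \int[mu]_(x in D `&` A) v x.
  rewrite Rintegral_mkcondr; apply: eq_Rintegral => x _.
  by rewrite patchE indicE; case: ifPn => _; rewrite ?mul1r ?mul0r.
by rewrite E; under eq_fun do rewrite E.
Qed.

Lemma tested_indicB A B : measurable A -> measurable B -> A `<=` B ->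
  tested \1_A -> tested \1_B -> tested \1_(B `\` A).
Proof.
move=> mA mB AB tA tB; rewrite /tested.
have E v : mu.-integrable D (EFin \o v) ->
    \int[mu]_(x in D) (\1_(B `\` A) x * v x) =
    \int[mu]_(x in D) (\1_B x * v x) - \int[mu]_(x in D) (\1_A x * v x).
  move=> iv; rewrite -RintegralB//.
  - apply: eq_Rintegral => x _; rewrite -mulrBl !indicE in_setD.
    have [xA|xA] := boolP (x \in A); last by rewrite andbT subr0.
    rewrite andbF (_ : x \in B) ?subrr// inE; apply: AB.
    by rewrite inE in xA.
  - apply: integrable_mul_bounded => // x _.
    by rewrite indicE; case: (_ \in _); rewrite ?normr1 ?normr0.
  - apply: integrable_mul_bounded => // x _.
    by rewrite indicE; case: (_ \in _); rewrite ?normr1 ?normr0.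
rewrite E//; under eq_fun do rewrite E//.
exact: cvgB.
Qed.

Lemma tested_bigcup (F : nat -> set T) : (forall k, measurable (F k)) ->
  nondecreasing_seq F -> (forall k, tested \1_(F k)) -> tested \1_(\bigcup_k F k).
Proof.
move=> mF ndF tF; apply: (@tested_lim (fun k => \1_(F k))) => //.
  by move=> j x _; rewrite indicE; case: (_ \in _); rewrite ?normr1 ?normr0.
move=> x _; rewrite indicE; have [xF|xF] := boolP (x \in _); last first.
  apply: cvg_near_cst; apply: nearW => j; rewrite indicE.
  rewrite memNset// => Fx; move: xF; rewrite notin_setE; apply.
  by exists j.
apply: cvg_near_cst; rewrite inE in xF; have [j _ Fjx] := xF.
exists j => // k /= jk; rewrite indicE mem_set//.
by move: Fjx; apply/subsetPset/ndF.
Qed.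

(** A Dynkin argument: the measurable sets with convergent tests form a lambda-system, and it
    contains the pi-system [P], whose indicators are bounded limits of admissible test functions. *)
Lemma tested_measurable (P : set (set T)) : setI_closed P ->
  @measurable _ T = <<s P >> -> P setT ->
  (forall U, P U -> exists psi : nat -> T -> R,
    [/\ forall j, measurable_fun D (psi j), forall j x, `|psi j x| <= 1,
        forall x, psi j x @[j --> \oo] --> (\1_U x : R) &
        forall j, tested (psi j)]) ->
  forall A, measurable A -> tested \1_A.
Proof.
move=> PI PE PT Papprox A mA.
have tP U : P U -> tested \1_U.
  move=> /Papprox[psi [mpsi psi1 psiU tpsi]].
  by apply: (tested_lim mpsi) => // x _; exact: psiU.
suff: <<s P >> `<=` [set A | measurable A /\ tested \1_A].
  by move=> /(_ A); rewrite -PE => /(_ mA)[].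
apply: lambda_system_subset => [//|||//].
- split=> //.
  + by split; [exact: measurableT|exact: tP].
  + move=> B A' AB [mB tB] [mA' tA']; split; first exact: measurableD.
    exact: tested_indicB.
  + move=> F ndF mF; split; first by apply: bigcup_measurable => k _; exact: (mF k).1.
    by apply: tested_bigcup => // k; [exact: (mF k).1|exact: (mF k).2].
- by move=> U PU; split; [rewrite PE; exact: sub_sigma_algebra|exact: tP].
Qed.

End tested.

(** * Lower semicontinuity of convex integrals *)

Section affine_integral.
Context {R : realType} d (T : measurableType d) {m : nat}.
Variables (mu : {measure set T -> \bar R}) (D : set T).
Hypotheses (mD : measurable D) (muD : (mu D < +oo)%E).

Lemma Rintegral_sum I (s : seq I) (F : I -> T -> R) :
  (forall i, mu.-integrable D (EFin \o F i)) ->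
  mu.-integrable D (EFin \o (fun x => \sum_(i <- s) F i x)) /\
  \int[mu]_(x in D) (\sum_(i <- s) F i x) =
  \sum_(i <- s) \int[mu]_(x in D) F i x.
Proof.
move=> iF; elim: s => [|i s [IH IHE]].
  rewrite big_nil; split.
    have := integrable0 mu D; apply: eq_integrable => // x _.
    by rewrite /= big_nil.
  under eq_Rintegral do rewrite big_nil.
  by rewrite Rintegral_cst// mul0r.
split.
  have := integrableD mD (iF i) IH; apply: eq_integrable => // x _.
  by rewrite /= big_cons EFinD.
under eq_Rintegral do rewrite big_cons.
by rewrite RintegralD// IHE big_cons.
Qed.

Lemma Rintegral_affine (h : 'rV[R]_m * R) (v : T -> 'rV[R]_m) :
  (forall i, mu.-integrable D (EFin \o (fun x => v x 0 i))) ->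
  mu.-integrable D (EFin \o (fun x => affine h (v x))) /\
  \int[mu]_(x in D) affine h (v x) =
  \sum_i h.1 0 i * \int[mu]_(x in D) v x 0 i + h.2 * fine (mu D).
Proof.
move=> iv.
have [iS ES] := @Rintegral_sum _ (index_enum 'I_m) (fun i x => h.1 0 i * v x 0 i)
  (fun i => integrableZl mD (h.1 0 i) (iv i)).
have ic : mu.-integrable D (EFin \o cst h.2).
  by apply: (@integrable_bounded_fun _ _ _ _ _ mD muD _ `|h.2|).
split; first exact: (integrableD mD iS ic).
rewrite RintegralD// Rintegral_cst// ES; congr (_ + _).
by apply: eq_bigr => i _; rewrite RintegralZl.
Qed.

End affine_integral.

Section lower_semicontinuity.
Context {R : realType} d (T : measurableType d) {m : nat}.
Variables (mu : {measure set T -> \bar R}) (D : set T).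
Hypotheses (mD : measurable D) (muD : (mu D < +oo)%E).
Variables (f : 'rV[R]_m -> R) (h : nat -> 'rV[R]_m * R).
Hypotheses (f_ge0 : forall z, 0 <= f z) (h_le : forall j z, affine (h j) z <= f z).
Hypothesis h_sup : forall z e, 0 < e -> exists j, f z - e < affine (h j) z.

(** Starting from 0 places every maximum between 0 and [f], so that [f] serves as a dominating
    function. *)
Fixpoint max_affine N z :=
  if N is N'.+1 then Num.max (max_affine N' z) (affine (h N') z) else 0.

Lemma max_affine_ge0 N z : 0 <= max_affine N z.
Proof. by elim: N => //= N IH; rewrite le_max IH. Qed.

Lemma max_affine_le N z : max_affine N z <= f z.
Proof. by elim: N => //= N IH; rewrite ge_max IH h_le. Qed.

Lemma affine_le_max j N z : (j < N)%N -> affine (h j) z <= max_affine N z.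
Proof.
elim: N => // N IH; rewrite ltnS leq_eqVlt => /predU1P[->|/IH jN] /=.
  by rewrite le_max lexx orbT.
by rewrite le_max jN.
Qed.

Lemma max_affine_cvg z : max_affine N z @[N --> \oo] --> f z.
Proof.
apply/cvgrPdist_lt => e e0; have [j fj] := h_sup z e0.
exists j.+1 => // N /= jN.
rewrite ger0_norm ?subr_ge0 ?max_affine_le//.
by have := affine_le_max z jN; move: fj; lra.
Qed.

Section composition.
Variable v : T -> 'rV[R]_m.
Hypothesis iv : forall i, mu.-integrable D (EFin \o (fun x => v x 0 i)).

Lemma measurable_max_affine N : measurable_fun D (fun x => max_affine N (v x)).
Proof.
elim: N => [|N IH].
  exact: measurable_cst.
apply: measurable_maxr => //; apply/measurable_EFinP.
exact: measurable_int (Rintegral_affine mD muD (h N) iv).1.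
Qed.

(** Only the coordinates of [v] are known to be measurable. This suffices, [f \o v] being a limit of
    finite maxima of affine functions of the coordinates. *)
Lemma measurable_convex_comp : measurable_fun D (f \o v).
Proof.
apply: (@measurable_fun_cvg _ _ _ _ (fun N x => max_affine N (v x))).
  exact: measurable_max_affine.
by move=> x _; exact: max_affine_cvg.
Qed.

End composition.

Variables (v_ : nat -> T -> 'rV[R]_m) (v : T -> 'rV[R]_m).
Hypothesis iv_ : forall k i, mu.-integrable D (EFin \o (fun x => v_ k x 0 i)).
Hypothesis iv : forall i, mu.-integrable D (EFin \o (fun x => v x 0 i)).
Hypothesis ifv_ : forall k, mu.-integrable D (EFin \o (f \o v_ k)).
Hypothesis ifv : mu.-integrable D (EFin \o (f \o v)).
Hypothesis v_v : forall A i, measurable A -> A `<=` D ->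
  \int[mu]_(x in A) v_ k x 0 i @[k --> \oo] --> \int[mu]_(x in A) v x 0 i.

Lemma affine_cvg A j : measurable A -> A `<=` D ->
  \int[mu]_(x in A) affine (h j) (v_ k x) @[k --> \oo] -->
  \int[mu]_(x in A) affine (h j) (v x).
Proof.
move=> mA AD.
have muA : (mu A < +oo)%E.
  by apply: le_lt_trans muD; apply: le_measure; rewrite ?inE.
have iA (w : T -> 'rV[R]_m) :
    (forall i, mu.-integrable D (EFin \o (fun x => w x 0 i))) ->
    forall i, mu.-integrable A (EFin \o (fun x => w x 0 i)).
  by move=> iw i; exact: integrableS (iw i).
rewrite (Rintegral_affine mA muA (h j) (iA _ iv)).2.
under eq_fun do rewrite (Rintegral_affine mA muA (h j) (iA _ (iv_ _))).2.
apply: cvgD; last exact: cvg_cst.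
apply: (@cvg_big R _ +%R 0 xpredT) => [|i _].
  exact: (@pseudometric_normed_Zmodule.add_continuous R R).
by apply: cvgM; [exact: cvg_cst|exact: v_v].
Qed.

(** Induction on [N] with [A] general. Where the last affine function is active, its integral
    converges and it lies below [f]; on the rest only the previous maximum remains and the induction
    hypothesis applies. Each piece costs [e / 2]. *)
Lemma max_affine_lsc N A (e : R) : measurable A -> A `<=` D -> 0 < e ->
  \forall k \near \oo, \int[mu]_(x in A) max_affine N (v x) - e <=
    \int[mu]_(x in A) f (v_ k x).
Proof.
elim: N A e => [|N IH] A e mA AD e0.
  apply: nearW => k; apply: (@le_trans _ _ 0); last exact: Rintegral_ge0.
  by rewrite Rintegral_cst// mul0r sub0r oppr_le0 ltW.
(* The functions are measurable on [D] only, so it is the trace of [S] on [D] that is known to be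
   measurable. *)
pose S := [set x | max_affine N (v x) < affine (h N) (v x)].
have mAS : measurable (A `&` S).
  have -> : A `&` S = A `&` (D `&` S).
    by rewrite setIA (setIidl AD).
  apply: measurableI => //.
  have := measurable_fun_ltr (measurable_max_affine iv N)
    ((measurable_EFinP _ _).1 (measurable_int _ (Rintegral_affine mD muD (h N) iv).1)).
  by move=> /(_ mD [set true] I).
have mADS : measurable (A `\` S).
  have -> : A `\` S = A `\` (A `&` S) by rewrite setDIr setDv set0U.
  exact: measurableD.
have AE : A = (A `&` S) `|` (A `\` S) by rewrite setUIDK.
have iM : mu.-integrable A (EFin \o (fun x => max_affine N.+1 (v x))).
  apply: (integrableS mD mA AD); apply: le_integrable ifv => //.
    exact/measurable_EFinP/measurable_max_affine.
  move=> x _; rewrite lee_fin (ger0_norm (f_ge0 _)).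
  by rewrite (ger0_norm (max_affine_ge0 N.+1 _)); exact: (max_affine_le N.+1).
have dis : [disjoint A `&` S & A `\` S].
  by apply/eqP/seteqP; split => // x [[_ Sx] [_ nSx]]; exact: nSx.
have IH2 := IH (A `\` S) (e / 2) mADS (subset_trans (@subDsetl _ _ _) AD).
have e2 : 0 < e / 2 by rewrite divr_gt0.
have := @affine_cvg _ N mAS (subset_trans (@subIsetl _ _ _) AD).
move=> /cvgrPdist_lt/(_ _ e2).
apply: filterS2 (IH2 e2) => k k2 k1.
have iA g : mu.-integrable A (EFin \o g) -> \int[mu]_(x in A) g x =
    \int[mu]_(x in A `&` S) g x + \int[mu]_(x in A `\` S) g x.
  by move=> ig; rewrite {1}AE Rintegral_setU// -AE.
rewrite iA//.
rewrite (iA (fun x => f (v_ k x)) (integrableS mD mA AD (ifv_ k))).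
rewrite (_ : \int[mu]_(x in A `&` S) max_affine N.+1 (v x) =
    \int[mu]_(x in A `&` S) affine (h N) (v x)); last first.
  apply: eq_Rintegral => x; rewrite inE => -[_ Sx].
  by rewrite /= (max_idPr (ltW Sx)).
rewrite (_ : \int[mu]_(x in A `\` S) max_affine N.+1 (v x) =
    \int[mu]_(x in A `\` S) max_affine N (v x)); last first.
  apply: eq_Rintegral => x; rewrite inE => -[_ /negP].
  by rewrite -leNgt /= => /max_idPl.
have : \int[mu]_(x in A `&` S) affine (h N) (v_ k x) <=
    \int[mu]_(x in A `&` S) f (v_ k x).
  have ASD : A `&` S `<=` D := subset_trans (@subIsetl _ _ _) AD.
  apply: le_Rintegral => //.
  - apply: (integrableS mD mAS ASD).
    exact: (Rintegral_affine mD muD (h N) (iv_ k)).1.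
  - exact: (integrableS mD mAS ASD (ifv_ k)).
move: k1; rewrite ltr_norml; move: k2; lra.
Qed.

Lemma convex_integral_lsc (e : R) : 0 < e ->
  \forall k \near \oo, \int[mu]_(x in D) f (v x) - e <=
    \int[mu]_(x in D) f (v_ k x).
Proof.
move=> e0; have e2 : 0 < e / 2 by rewrite divr_gt0.
have M_le N x : D x -> `|max_affine N (v x)| <= f (v x).
  by move=> _; rewrite ger0_norm ?max_affine_ge0 ?max_affine_le.
have [_ /cvgrPdist_lt/(_ _ e2)[N _ /(_ N (leqnn N)) /= NP]] :=
  Rintegral_dominated_cvg mD (measurable_max_affine iv)
    (fun x _ => @max_affine_cvg (v x)) ifv M_le.
apply: filterS (max_affine_lsc N mD (@subset_refl _ D) e2) => k.
by move: NP; rewrite ltr_norml; lra.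
Qed.

End lower_semicontinuity.

(** * Test functions of quadratic growth *)

Section quadratic_growth.
Context {R : realType} {m : nat}.
Implicit Type z : 'rV[R]_m.

Lemma continuous_1Denorm2 : continuous (fun z => 1 + enorm z ^+ 2).
Proof.
move=> z; have c1 := @cst_continuous 'rV[R]_m R 1 z.
have := continuousD c1 (@continuous_enorm2 R m z); exact.
Qed.

Lemma quad_continuous (f : 'rV[R]_m -> R) : quad_class f -> continuous f.
Proof.
move=> [f0 [f0c _ _ _] fE] x.
have -> : f = (fun z => 1 + enorm z ^+ 2) \* f0 by apply/funext => z; exact: fE.
exact: (continuousM (@continuous_1Denorm2 x) (f0c x)).
Qed.

Lemma quad_growth (f : 'rV[R]_m -> R) : quad_class f ->
  exists C, forall z, `|f z| <= C * (1 + enorm z ^+ 2).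
Proof.
move=> [f0 [_ [M [_ Mf0]] _ _] fE]; exists (M + 1) => z.
have q0 : 0 <= 1 + enorm z ^+ 2 by rewrite addr_ge0// sqr_ge0.
rewrite fE normrM ger0_norm// mulrC ler_wpM2r//.
by apply: Mf0 => //; rewrite ltrDl.
Qed.

Lemma quad_class1Denorm2 : quad_class (fun z => 1 + enorm z ^+ 2).
Proof.
exists (cst 1) => [|z]; last by rewrite mulr1.
split.
- exact: cst_continuous.
- exists 1; split; first exact: num_real.
  by move=> r r1 x _ /=; rewrite normr1 ltW.
- by move=> z _; apply: is_cvg_cst.
- rewrite (_ : (fun z => _) = cst (1 : R)); last first.
    by apply/funext => z; rewrite lim_cst.
  by apply: continuous_subspaceT => x; exact: cst_continuous.
Qed.

(** Linear against quadratic growth in [s]. The degenerate case [q = 0] covers the ray through the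
    origin, where the numerator vanishes too. *)
Lemma cvg_lin_div_quad (a q : R) : 0 <= q -> (q = 0 -> a = 0) ->
  s * a / (1 + s ^+ 2 * q) @[s --> +oo] --> 0.
Proof.
move=> q0 qa; have [qE|qN] := eqVneq q 0.
  rewrite (_ : (fun s => _) = cst (0 : R)); first exact: cvg_cst.
  by apply/funext => s; rewrite (qa qE) mulr0 mul0r.
have {}q0 : 0 < q by rewrite lt_neqAle eq_sym qN.
apply/cvgrPdist_lt => e e0; near=> s.
have s0 : 0 < s by near: s; exact: nbhs_pinfty_gt.
have sa : `|a| / (e * q) < s by near: s; apply: nbhs_pinfty_gt; exact: num_real.
have p : 0 < 1 + s ^+ 2 * q by rewrite addr_gt0// mulr_gt0// exprn_gt0.
rewrite sub0r normrN !normrM (gtr0_norm s0) normfV (gtr0_norm p).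
rewrite ltr_pdivrMr//; move: sa; rewrite ltr_pdivrMr ?mulr_gt0// => sa.
rewrite mulrDr mulr1 ltr_pwDl// (_ : e * _ = s * (s * (e * q))); last by ring.
by rewrite ler_wpM2l// ltW.
Unshelve. all: by end_near. Qed.

Lemma quad_class_coord i : quad_class (fun z => z 0 i).
Proof.
have q0 z : 0 < 1 + enorm z ^+ 2 by rewrite ltr_pwDl// sqr_ge0.
exists (fun z => z 0 i / (1 + enorm z ^+ 2)); last first.
  by move=> z; rewrite mulrCA mulfV ?mulr1// gt_eqF.
have lim0 z : (s *: z) 0 i / (1 + enorm (s *: z) ^+ 2) @[s --> +oo] --> (0 : R).
  under eq_cvg do rewrite mxE enorm2Z.
  apply: cvg_lin_div_quad => [|qz]; first exact: sqr_ge0.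
  apply/eqP; rewrite -sqrf_eq0 eq_le sqr_ge0 andbT.
  by rewrite -qz coord2_le.
split.
- move=> x; apply: (continuousM (@coord_continuous _ _ _ 0 i x)).
  apply: continuousV; first by rewrite gt_eqF.
  exact: continuous_1Denorm2.
- exists 1; split; first exact: num_real.
  move=> r /ltW r1 z _ /=; apply: le_trans r1.
  rewrite normrM normfV (gtr0_norm (q0 z)) ler_pdivrMr// mul1r.
  have := coord2_le z i; rewrite -real_normK ?num_real// => H.
  (* From [2 * |z_i| <= 1 + z_i^2]. *)
  by have := sqr_ge0 (`|z 0 i| - 1); nra.
- by move=> z _; apply/cvg_ex; exists 0; exact: lim0.
- rewrite (_ : (fun z => _) = cst (0 : R)); last first.
    by apply/funext => z; apply/cvg_lim => //; exact: lim0.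
  by apply: continuous_subspaceT => x; exact: cst_continuous.
Qed.

Lemma recession_coord i : recession (fun z => z 0 i) = cst (0 : R).
Proof.
apply/funext => z; apply/cvg_lim => //.
under eq_cvg => s do rewrite mxE -[s ^+ 2]mulr1.
by apply: cvg_lin_div_quad => // /eqP; rewrite oner_eq0.
Qed.

Lemma recession_1Denorm2 z : usphere z -> recession (fun z => 1 + enorm z ^+ 2) z = 1.
Proof.
move=> z1; apply/cvg_lim => //; under eq_cvg => s.
  rewrite enorm2Z z1 expr1n mulr1 mulfV; last by rewrite gt_eqF// ltr_pwDl// sqr_ge0.
  over.
exact: cvg_cst.
Qed.

End quadratic_growth.

(** * Upper semicontinuity of the variance *)

Lemma Rintegral_eq0 {R : realType} d (T : measurableType d)
    (mu : {measure set T -> \bar R}) (D : set T) (f : T -> R) :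
  (forall x, D x -> f x = 0) -> \int[mu]_(x in D) f x = 0.
Proof.
by move=> f0; rewrite /Rintegral integral0_eq// => x Dx; rewrite f0.
Qed.

Section barycenters.
Context {R : realType} {m : nat}.
Variable P : probability 'rV[R]_m R.

Lemma affine_barycenter (h : 'rV[R]_m * R) :
  (forall i, P.-integrable setT (EFin \o (fun z : 'rV[R]_m => z 0 i))) ->
  P.-integrable setT (EFin \o affine h) /\
  affine h (barycenter P) = \int[P]_z affine h z.
Proof.
move=> iz; have PT : (P setT < +oo)%E by rewrite -ge0_fin_numE// fin_num_measure.
have [ih ->] := @Rintegral_affine R _ _ m P setT measurableT PT h id iz.
split => //; rewrite /affine; congr (_ + _).
  by apply: eq_bigr => i _; rewrite mxE.
have -> : fine (P setT) = 1 by rewrite probability_setT.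
  by rewrite mulr1.
Qed.

(** Jensen's inequality: affine functions commute with the barycenter, and [f] is the supremum of
    the [affine (h j)]. *)
Lemma convex_barycenter_le (f : 'rV[R]_m -> R) (h : nat -> 'rV[R]_m * R) :
  (forall j z, affine (h j) z <= f z) ->
  (forall z e, 0 < e -> exists j, f z - e < affine (h j) z) ->
  (forall i, P.-integrable setT (EFin \o (fun z : 'rV[R]_m => z 0 i))) ->
  P.-integrable setT (EFin \o f) ->
  f (barycenter P) <= \int[P]_z f z.
Proof.
move=> hf fh iz jf; apply/ler_addgt0Pr => e e0.
have [j fj] := fh (barycenter P) e e0.
have [ih hE] := affine_barycenter (h j) iz.
have : affine (h j) (barycenter P) <= \int[P]_z f z by rewrite hE; exact: le_Rintegral.
lra.
Qed.

(** Integrates the pointwise bound that follows from [(delta * |z_i| - 1)^2 >= 0]. This is the form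
    in which second moments enter [test_error]. *)
Lemma norm_barycenter_le (i : 'I_m) (delta : R) : 0 < delta ->
  P.-integrable setT (EFin \o (fun z : 'rV[R]_m => z 0 i)) ->
  P.-integrable setT (EFin \o (fun z : 'rV[R]_m => 1 + enorm z ^+ 2)) ->
  `|barycenter P 0 i| <= delta^-1 + delta * \int[P]_z (1 + enorm z ^+ 2).
Proof.
move=> d0 iz iq; rewrite mxE.
apply: (le_trans (le_normr_Rintegral measurableT iz)).
have ic : P.-integrable setT (EFin \o cst delta^-1).
  exact: finite_measure_integrable_cst.
have id := integrableZl measurableT delta iq.
rewrite (_ : _ + _ = \int[P]_z (delta^-1 + delta * (1 + enorm z ^+ 2))); last first.
  rewrite (@RintegralD _ _ _ P setT (cst delta^-1))// RintegralZl//.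
  rewrite Rintegral_cst//.
  have -> : fine (P setT) = 1 by rewrite probability_setT.
  by rewrite mulr1.
apply: le_Rintegral => //.
- exact: integrable_norm.
- exact: (integrableD measurableT ic id).
move=> z _; have := coord2_le z i.
rewrite -real_normK ?num_real//; set a := `|z 0 i| => az.
have dd : delta * delta^-1 = 1 by rewrite mulfV// gt_eqF.
rewrite -(ler_pM2l d0) mulrDr dd.
have := sqr_ge0 (delta * a - 1); nra.
Qed.

End barycenters.

Section variance_usc.
Context {R : realType} {n m : nat}.
Variables (Omega : set 'rV[R]_n) (f : 'rV[R]_m -> R).
Notation L := (@lebesgue_rV R n).
Hypotheses (Omega_open : open Omega) (Omega_bounded : bounded_set Omega).
Hypothesis f_quad : quad_class f.
Hypothesis f_convex : convex_function (setT : set (convex_lmodType 'rV[R]_m)) f.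
Hypothesis f_ge0 : forall z, 0 <= f z.
Variables (Yk : nat -> @young_triple R n m) (Y : @young_triple R n m).
Hypothesis Yk_young : forall k, gen_young Omega (Yk k).
Hypothesis Y_young : gen_young Omega Y.
Hypothesis Yk_Y : young_cvg Omega Yk Y.

(** [None] stands for the limit and [Some k] for the terms of the sequence. The index type is
    countable, which lets a single null set serve all of them. *)
Let W (w : option nat) := oapp Yk Y w.

Let test (j : option (option 'I_m)) : 'rV[R]_m -> R :=
  match j with
  | None => f
  | Some None => fun z => 1 + enorm z ^+ 2
  | Some (Some i) => fun z => z 0 i
  end.

Let W_young w : gen_young Omega (W w).
Proof. by case: w. Qed.

Let test_quad j : quad_class (test j).
Proof.
by case: j => [[i|]|] //=; [exact: quad_class_coord|exact: quad_class1Denorm2].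
Qed.

Let test_moment w j : exists2 N, null L N &
  (forall x, (Omega `\` N) x ->
    (oscillation (W w) x).-integrable setT (EFin \o test j)) /\
  L.-integrable (Omega `\` N)
    (EFin \o (fun x => \int[oscillation (W w) x]_z test j z)).
Proof.
have [C fC] := quad_growth (test_quad j).
apply: (@oscillation_integrable _ _ _ _ _ Omega_open Omega_bounded (W_young w) _ C) => //.
by apply: continuous_measurable_rV_fun; exact: quad_continuous.
Qed.

Let common_null : exists2 N, null L N &
  (forall w j x, (Omega `\` N) x ->
    (oscillation (W w) x).-integrable setT (EFin \o test j)) /\
  (forall w j, L.-integrable (Omega `\` N)
    (EFin \o (fun x => \int[oscillation (W w) x]_z test j z))).
Proof.
have mO : measurable Omega := open_measurable_rV Omega_open.
pose Nw (wj : option nat * option (option 'I_m)) := cid2 (test_moment wj.1 wj.2).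
have N0 : null L (\bigcup_wj s2val (Nw wj)).
  by apply: null_bigcup => wj; exact: (s2valP (Nw wj)).
have NS w j : Omega `\` \bigcup_wj s2val (Nw wj) `<=` Omega `\` s2val (Nw (w, j)).
  by apply: setDS => x Nx; exists (w, j).
exists (\bigcup_wj s2val (Nw wj)) => //; split => [w j x Ox|w j].
  by apply: (s2valP' (Nw (w, j))).1; exact: NS.
apply: integrableS (s2valP' (Nw (w, j))).2 => //.
- by apply: measurableD => //; exact: (s2valP (Nw (w, j))).1.
- by apply: measurableD => //; exact: N0.1.
Qed.

Lemma variance_usc (e : R) : 0 < e ->
  \forall k \near \oo,
    young_variance Omega f (Yk k) <= young_variance Omega f Y + e.
Proof.
move=> e0; have mO : measurable Omega := open_measurable_rV Omega_open.
have [N N0 [iP iL]] := common_null.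
pose D := Omega `\` N.
have mD : measurable D by apply: measurableD => //; exact: N0.1.
have LD : (L D < +oo)%E.
  apply: le_lt_trans (lebesgue_rV_bounded Omega_open Omega_bounded).
  by apply: le_measure; rewrite ?inE//; exact: subDsetl.
have [h [hf fh]] := convex_countable_minorants (quad_continuous f_quad) f_ge0 f_convex.
pose b w x := barycenter (oscillation (W w) x).
have bE w x i : b w x 0 i = \int[oscillation (W w) x]_z test (Some (Some i)) z.
  by rewrite mxE.
have ib w i : L.-integrable D (EFin \o (fun x => b w x 0 i)).
  have := iL w (Some (Some i)); apply: eq_integrable => // x _.
  by rewrite /= bE.
have fb w x : D x -> f (b w x) <= \int[oscillation (W w) x]_z f z.
  move=> Dx; apply: (convex_barycenter_le hf fh) => [i|].
    exact: (iP w (Some (Some i)) x Dx).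
  exact: (iP w None x Dx).
have ifb w : L.-integrable D (EFin \o (f \o b w)).
  apply: le_integrable (iL w None) => //.
    apply/measurable_EFinP.
    exact: (measurable_convex_comp mD LD f_ge0 hf fh (ib w)).
  move=> x Dx; rewrite lee_fin (ger0_norm (f_ge0 _)) /=.
  by apply: le_trans (fb w x Dx) (ler_norm _).
(* Splitting the integral needs both terms integrable, which is known off [N]. *)
have VE w : young_variance Omega f (W w) =
    young_pairing Omega (W w) (cst 1) f - \int[L]_(x in D) f (b w x).
  rewrite /young_variance /young_pairing !(Rintegral_setD_null Omega _ N0) -/D.
  rewrite (RintegralB mD (iL w None) (ifb w)).
  rewrite addrAC; congr (_ + _ - _).
    by apply: eq_Rintegral => x _; rewrite mul1r.
  by apply: eq_Rintegral => x _; rewrite mul1r.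
have c1 : {within closure Omega, continuous (cst (1 : R))}.
  by apply: continuous_subspaceT => x; exact: cst_continuous.
pose G w x := \int[oscillation (W w) x]_z (1 + enorm z ^+ 2).
have G0 w x : 0 <= G w x.
  by apply: Rintegral_ge0 => z _; rewrite addr_ge0// sqr_ge0.
(* The concentration part of this pairing is non-negative, its recession function being 1 on the
   sphere. *)
have G_le w : \int[L]_(x in D) G w x <=
    young_pairing Omega (W w) (cst 1) (fun z => 1 + enorm z ^+ 2).
  rewrite /young_pairing (Rintegral_setD_null Omega _ N0) -/D.
  rewrite [leLHS](_ : _ = \int[L]_(x in D) (cst 1 x * G w x)); last first.
    by apply: eq_Rintegral => x _; rewrite mul1r.
  rewrite lerDl; apply: Rintegral_ge0 => x _; rewrite mul1r.
  by apply: Rintegral_ge0 => z Sz; rewrite recession_1Denorm2.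
(* The pairings converge and are thus bounded; the maximum also accounts for the limit. *)
have [C GC] : exists C, forall w, \int[L]_(x in D) G w x <= C.
  have /cvg_ex/cvg_seq_bounded [M [_ MP]] :
    exists l : R, young_pairing Omega (Yk k) (cst 1) (fun z => 1 + enorm z ^+ 2)
      @[k --> \oo] --> l by eexists; exact: (Yk_Y c1 quad_class1Denorm2).
  exists (Num.max (M + 1) (\int[L]_(x in D) G None x)) => -[k|]; last first.
    by rewrite le_max lexx orbT.
  rewrite le_max; apply/orP; left; apply: le_trans (G_le (Some k)) _.
  apply: le_trans (ler_norm _) _.
  by apply: MP => //; rewrite ltrDl.
have bG w i x delta : D x -> 0 < delta ->
    `|b w x 0 i| <= delta^-1 + delta * G w x.
  move=> Dx d0; apply: norm_barycenter_le => //.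
    exact: (iP w (Some (Some i)) x Dx).
  exact: (iP w (Some None) x Dx).
have iG w : L.-integrable D (EFin \o G w) by exact: (iL w (Some None)).
pose tst i := tested L D (fun k x => b (Some k) x 0 i) (fun x => b None x 0 i).
(* Coordinates have zero recession function, so the concentration part vanishes and weak-*
   convergence speaks of the barycenters alone. *)
have tst_cont i phi : continuous phi -> tst i phi.
  move=> cphi.
  have cphi' : {within closure Omega, continuous phi}.
    exact: continuous_subspaceT.
  have PE w : young_pairing Omega (W w) phi (fun z => z 0 i) =
      \int[L]_(x in D) (phi x * b w x 0 i).
    rewrite /young_pairing (Rintegral_setD_null Omega _ N0) -/D recession_coord.
    rewrite [X in _ + X]Rintegral_eq0 => [|x _]; last first.
      by rewrite Rintegral_eq0 ?mulr0.
    by rewrite addr0; apply: eq_Rintegral => x _; rewrite bE.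
  have := Yk_Y cphi' (quad_class_coord i).
  rewrite (PE None) (_ : (fun k => _) =
    fun k => \int[L]_(x in D) (phi x * b (Some k) x 0 i))//.
  by apply/funext => k; exact: (PE (Some k)).
(* The pi-system consists of the open sets, with continuous approximations of their indicators. *)
have tst_meas i A : measurable A -> tst i \1_A.
  apply: (@tested_measurable _ _ _ _ _ mD LD _ _ _ _ C
    (fun k => ib (Some k) i) (ib None i) (fun k => iG (Some k)) (iG None)
    (fun k x _ => G0 (Some k) x) (fun x _ => G0 None x)
    (fun k => GC (Some k)) (GC None)
    (fun k x delta => @bG (Some k) i x delta) (fun x delta => @bG None i x delta)
    (@open 'rV[R]_n)) => //.
  - by move=> U V; exact: openI.
  - exact: openT.
  move=> U /open_indic_cvg[phi [phic phi01 phiU]]; exists phi; split => //.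
  - by move=> j; apply: measurable_funTS; exact: continuous_measurable_rV_fun.
  - by move=> j x; have /andP[p0 p1] := phi01 j x; rewrite ger0_norm.
  - by move=> j; exact: tst_cont.
have bcvg A i : measurable A -> A `<=` D ->
    \int[L]_(x in A) b (Some k) x 0 i @[k --> \oo] --> \int[L]_(x in A) b None x 0 i.
  move=> mA AD; have := tested_indicP mA (tst_meas i A mA).
  by rewrite (setIidr AD).
have e2 : 0 < e / 2 by rewrite divr_gt0.
have := convex_integral_lsc mD LD f_ge0 hf fh (fun k => ib (Some k)) (ib None)
  (fun k => ifb (Some k)) (ifb None) bcvg e2.
have /cvgrPdist_lt/(_ _ e2) := Yk_Y c1 f_quad.
apply: filterS2 => k; rewrite ltr_norml => /andP[k1 _] k2.
have := VE (Some k); have := VE None; rewrite /W /= => -> ->.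
by move: k1 k2; rewrite /=; lra.
Qed.

End variance_usc.

(** * Existence of a maximiser by the direct method *)

Theorem theorem2p11 (R : realType) (n m : nat) (Omega : set 'rV[R]_n)
    (f : 'rV[R]_m -> R) (M : set (@young_triple R n m))
    (Omega_open : open Omega) (Omega_bounded : bounded_set Omega)
    (f_quad : quad_class f)
    (f_convex : convex_function (setT : set (convex_lmodType 'rV[R]_m)) f)
    (f_ge0 : forall z, 0 <= f z)
    (M_young : M `<=` gen_young Omega)
    (M_neq0 : M !=set0)
    (M_compact : young_seq_compact Omega M) :
  exists2 Y, M Y &
    forall Y', M Y' -> young_variance Omega f Y' <= young_variance Omega f Y.
Proof.
pose V := young_variance Omega f.
have usc (Yk : nat -> young_triple n m) : (forall k, M (Yk k)) ->
    exists sigma : nat -> nat, exists Y, [/\ forall k, (k <= sigma k)%N, M Y &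
      forall e, 0 < e -> \forall k \near \oo, V (Yk (sigma k)) <= V Y + e].
  move=> MYk; have [sigma [Y [sigma_lt MY YkY]]] := M_compact Yk MYk.
  exists sigma, Y; split => // [k|e e0].
    by elim: k => // k IH; exact: leq_ltn_trans IH (sigma_lt _ _ _).
  have Yk_young k : gen_young Omega ((Yk \o sigma) k) by exact/M_young/MYk.
  exact: (variance_usc Omega_open Omega_bounded f_quad f_convex f_ge0
    Yk_young (M_young _ MY) YkY e0).
have VM0 : (V @` M) !=set0 by have [Y MY] := M_neq0; exists (V Y), Y.
(* If [V] were unbounded on [M], a sequence with [V (Yk k) > k] would have a subsequence on which
   [V] is eventually at most [V Y + 1]. *)
have VMub : has_ubound (V @` M).
  apply: contrapT => noub.
  have H (k : nat) : {Y | M Y /\ k%:R < V Y}.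
    apply: cid; apply: contrapT => Hk; apply: noub; exists k%:R => _ [Y MY <-].
    by rewrite leNgt; apply/negP => kY; apply: Hk; exists Y.
  have [|sigma [Y [sk MY /(_ 1 ltr01)]]] := usc (fun k => sval (H k)).
    by move=> k; have [] := svalP (H k).
  move=> [N _ NP].
  (* Beyond [N] and above [V Y + 1]; since [k <= sigma k], the value at [sigma k] exceeds [V Y + 1]
     as well. *)
  pose k := maxn N (Num.truncn (`|V Y| + 1)).+1.
  have := NP k (leq_maxl _ _); apply/negP; rewrite -ltNge.
  have [_] := svalP (H (sigma k)); apply: le_lt_trans.
  apply: (@le_trans _ _ k%:R); last by rewrite ler_nat.
  apply: (@le_trans _ _ (Num.truncn (`|V Y| + 1)).+1%:R); last first.
    by rewrite ler_nat leq_maxr.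
  apply: (@le_trans _ _ (`|V Y| + 1)); first by rewrite lerD2r ler_norm.
  by have /andP[_ /ltW] := truncn_itv (addr_ge0 (normr_ge0 (V Y)) ler01).
have VMsup : has_sup (V @` M) by split.
have H (k : nat) : {Y | M Y /\ sup (V @` M) - k.+1%:R^-1 < V Y}.
  apply: cid; have k0 : 0 < k.+1%:R^-1 :> R by rewrite invr_gt0.
  by have [_ [Y MY <-] Yk] := sup_adherent k0 VMsup; exists Y.
have [|sigma [Y [sk MY uscY]]] := usc (fun k => sval (H k)).
  by move=> k; have [] := svalP (H k).
exists Y => // Y' MY'.
apply: (@le_trans _ _ (sup (V @` M))).
  by apply: ub_le_sup => //; exists Y'.
(* One [e / 2] pays for the gap between the maximising sequence and the supremum, the other for
   upper semicontinuity. *)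
apply/ler_addgt0Pr => e e0; have e2 : 0 < e / 2 by rewrite divr_gt0.
have := near_infty_natSinv_lt (PosNum e2) => /=.
have [N1 _ N1P] := uscY _ e2.
move=> [N2 _ N2P]; pose k := maxn N1 N2.
have := N1P k (leq_maxl _ _); have := N2P (sigma k) (leq_trans (leq_maxr _ _) (sk k)).
have [_] := svalP (H (sigma k)); rewrite -/(V Y).
set S := sup _; set v := V (sval _); set a := _.+1%:R^-1.
rewrite [in X in X -> _]/=; lra.
Qed.
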